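(* Let $G$ be a (possibly infinite dimensional) Lie group with Lie algebra $\mathfrak g$, let $\langle\ ,\ \rangle$ be a positive definite bounded (weak) inner product on $\mathfrak g$, and suppose that for every $\xi\in\mathfrak g$ the adjoint $\mathrm{ad}(\xi)^\top$ of $\mathrm{ad}(\xi)$ with respect to $\langle\ ,\ \rangle$ exists. Let $g:[a,b]\to G$ be a smooth curve with right logarithmic derivative $u(t)=T(\mu^{g(t)^{-1}})\cdot g'(t)\in\mathfrak g$. Then $g$ is a geodesic of the right invariant metric defined by $\langle\ ,\ \rangle$, i.e. a critical point of the energy $$E(g)=\tfrac12\int_a^b\langle u(t),u(t)\rangle\,dt$$ with respect to smooth variations with fixed endpoints, if and only if $$u_t=-\mathrm{ad}(u)^\top u .$$
   Context: $\mu^y:G\to G$, $\mu^y(x)=xy$, is right translation. The bracket on $\mathfrak g=T_eG$ is the usual one (from left invariant vector fields), $\mathrm{ad}(\xi)\eta=[\xi,\eta]$. The right invariant (weak) Riemannian metric on $G$ is $G_x(\xi,\eta)=\langle T(\mu^{x^{-1}})\xi,\,T(\mu^{x^{-1}})\eta\rangle$ for $\xi,\eta\in T_xG$. The adjoint $\mathrm{ad}(\xi)^\top:\mathfrak g\to\mathfrak g$ is the linear map with $\langle \mathrm{ad}(\xi)\eta,\zeta\rangle=\langle\eta,\mathrm{ad}(\xi)^\top\zeta\rangle$ for all $\eta,\zeta\in\mathfrak g$ (its existence is an assumption in infinite dimensions, where the inner product need only be weak, i.e. $\mathfrak g\to\mathfrak g^*$ injective). Infinite dimensional Lie groups are understood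 in the sense of convenient calculus: smooth manifolds modeled on convenient vector spaces with smooth group operations. *)

(* Defs.v *)
From HB Require Import structures.
From mathcomp Require Import all_boot all_order all_algebra.
From mathcomp Require Import all_classical all_reals all_analysis.
Import Order.TTheory GRing.Theory Num.Theory.
Import numFieldNormedType.Exports.

Set Implicit Arguments.
Unset Strict Implicit.
Unset Printing Implicit Defensive.

Local Open Scope classical_set_scope.
Local Open Scope ring_scope.

(** * Convenient calculus (Frölicher, Kriegl, Michor) *)

(* The library's [derive1] requires a normed codomain; these are its analogues
   for a locally convex codomain. *)
Definition tvs_is_derive {R : realType} {E : tvsType R} (c : R -> E) (t : R)
    (v : E) : Prop :=
  h^-1 *: (c (h + t) - c t) @[h --> (0 : R)^'] --> v.

Definition tvs_derivable {R : realType} {E : tvsType R} (c : R -> E) (t : R) : Prop :=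
  exists v : E, tvs_is_derive c t v.

Definition tvs_derive {R : realType} {E : tvsType R} (c : R -> E) (t : R) : E :=
  xget 0 [set v | tvs_is_derive c t v].

(* Meaningful for open J only: a derivative at t depends on c near t. *)
Definition smooth_on {R : realType} {E : tvsType R} (J : set R) (c : R -> E) : Prop :=
  forall (n : nat) (t : R), J t -> tvs_derivable (iter n tvs_derive c) t.

Definition smooth {R : realType} {E : tvsType R} (c : R -> E) : Prop :=
  smooth_on setT c.

Definition dir_derive {R : realType} {E F : tvsType R} (X : E -> F) (x v : E) : F :=
  tvs_derive (fun s => X (x + s *: v)) 0.

(* c^oo-completeness, in the form "weakly smooth curves are smooth". *)
Definition convenient {R : realType} (E : tvsType R) : Prop :=
  hausdorff_space E /\
  forall c : R -> E,
    (forall l : E -> R, scalar l -> continuous l -> smooth (l \o c)) -> smooth c.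

Definition cinf_open {R : realType} {E : tvsType R} (U : set E) : Prop :=
  forall c : R -> E, smooth c -> open (c @^-1` U).

Definition smooth_map {R : realType} {E F : tvsType R} (U : set E) (f : E -> F) : Prop :=
  forall c : R -> E, smooth c -> (forall t, U (c t)) -> smooth (f \o c).

Definition vN_bounded {R : realType} {E : tvsType R} (B : set E) : Prop :=
  forall U : set E, nbhs 0 U ->
    exists2 r : R, 0 < r & forall k : R, r <= `|k| -> B `<=` [set k *: x | x in U].

(** * Manifolds modeled on convenient vector spaces *)

(* Only the restrictions of [chart_map] to [chart_dom] and of [chart_inv] to
   the image [chart_map @` chart_dom] are meaningful.  The modeling space may
   depend on the chart. *)
Record chart (R : realType) (M : Type) := Chart {
  chart_model : tvsType R;
  chart_dom : set M;
  chart_map :> M -> chart_model;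
  chart_inv : chart_model -> M;
  chart_convenient : convenient chart_model;
  chart_mapK : forall x, chart_dom x -> chart_inv (chart_map x) = x;
  chart_image_open : cinf_open (chart_map @` chart_dom)
}.
Arguments chart_inv {R M} c v.

Definition smooth_atlas {R : realType} {M I : Type} (A : I -> chart R M) : Prop :=
  (forall x : M, exists i, chart_dom (A i) x) /\
  (forall i j : I,
     let V := A i @` (chart_dom (A i) `&` chart_dom (A j)) in
     cinf_open V /\ smooth_map V (chart_map (A j) \o chart_inv (A i))).

Definition mfd_open {R : realType} {M I : Type} (A : I -> chart R M) (W : set M) : Prop :=
  forall i : I, cinf_open (A i @` (W `&` chart_dom (A i))).

Definition mfd_hausdorff {R : realType} {M I : Type} (A : I -> chart R M) : Prop :=
  forall x y : M, x <> y -> exists V W : set M,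
    [/\ mfd_open A V, mfd_open A W, V x, W y & V `&` W = set0].

Definition smooth_manifold {R : realType} {M I : Type} (A : I -> chart R M) : Prop :=
  smooth_atlas A /\ mfd_hausdorff A.

(* Smooth curves J -> M, J an open set of reals. *)
Definition smooth_curve {R : realType} {M I : Type} (A : I -> chart R M)
    (J : set R) (c : R -> M) : Prop :=
  forall i : I,
    let Ji := J `&` c @^-1` chart_dom (A i) in
    open Ji /\ smooth_on Ji (chart_map (A i) \o c).

(* Smooth maps W -> M, W an open subset of the plane: as for all maps between
   manifolds in convenient calculus, smooth curves go to smooth curves. *)
Definition smooth_surface {R : realType} {M I : Type} (A : I -> chart R M)
    (W : set (R * R)) (h : R -> R -> M) : Prop :=
  forall c d : R -> R, smooth c -> smooth d -> (forall t, W (c t, d t)) ->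
    smooth_curve A setT (fun t => h (c t) (d t)).

(** * Lie groups *)

(* A smooth curve in the manifold G * G is a pair of smooth curves in G, so
   the last two clauses say that multiplication and inversion are smooth. *)
Definition lie_group {R : realType} {G : groupType} {I : Type} (A : I -> chart R G) : Prop :=
  [/\ smooth_manifold A,
      (forall c d : R -> G, smooth_curve A setT c -> smooth_curve A setT d ->
         smooth_curve A setT (fun t => (c t * d t)%g))
    & (forall c : R -> G, smooth_curve A setT c ->
         smooth_curve A setT (fun t => (c t)^-1%g))].

(* From here on p is a chart around the unit e, and the Lie algebra T_e G is
   identified with [chart_model p] through p: the tangent vector of a curve c
   with c 0 = e is the derivative of p \o c at 0. *)

(* The left invariant vector field x |-> T(y |-> x y) xi, read in the chart p. *)
Definition left_inv_field {R : realType} {G : groupType} (p : chart R G)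
    (xi : chart_model p) (x : chart_model p) : chart_model p :=
  tvs_derive
    (fun s => p (chart_inv p x * chart_inv p (p 1%g + s *: xi))%g) 0.

(* [X, Y] = dY . X - dX . Y, that is, the vector field of the derivation
   f |-> X (Y f) - Y (X f). *)
Definition field_bracket {R : realType} {E : tvsType R} (X Y : E -> E) (x : E) : E :=
  dir_derive Y x (X x) - dir_derive X x (Y x).

Definition lie_ad {R : realType} {G : groupType} (p : chart R G)
    (xi eta : chart_model p) : chart_model p :=
  field_bracket (left_inv_field xi) (left_inv_field eta) (p 1%g).

(* u(t) = T(x |-> x g(t)^-1) g'(t) is the tangent vector at s = t of the curve
   s |-> g(s) g(t)^-1, which passes through e at s = t. *)
Definition right_log_derive {R : realType} {G : groupType} (p : chart R G)
    (g : R -> G) (t : R) : chart_model p :=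
  tvs_derive (fun s => p (g s * (g t)^-1)%g) t.

(** * Right invariant metrics *)

Record weak_inner_product {R : realType} {E : tvsType R} (ip : E -> E -> R) : Prop := {
  ip_linear : forall y, scalar (ip ^~ y);
  ip_sym : forall x y, ip x y = ip y x;
  ip_pos : forall x, x != 0 -> 0 < ip x x;
  ip_bounded : forall B : set E, vN_bounded B ->
    exists C : R, forall x y, B x -> B y -> `|ip x y| <= C
}.

Definition is_adjoint {R : realType} {E : tvsType R} (ip : E -> E -> R)
    (f ft : E -> E) : Prop :=
  linear ft /\ forall eta zeta, ip (f eta) zeta = ip eta (ft zeta).

Definition energy {R : realType} {G : groupType} (p : chart R G)
    (ip : chart_model p -> chart_model p -> R) (a b : R) (g : R -> G) : R :=
  2^-1 * (\int[lebesgue_measure]_(t in `[a, b])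
            ip (right_log_derive p g t) (right_log_derive p g t))%R.

(* A smooth map on the closed interval [a, b] is one with a smooth extension
   to an open neighbourhood of it. *)
Definition smooth_path {R : realType} {G : groupType} {I : Type} (A : I -> chart R G)
    (a b : R) (g : R -> G) : Prop :=
  exists2 d : R, 0 < d & smooth_curve A `]a - d, b + d[ g.

Definition variation {R : realType} {G : groupType} {I : Type} (A : I -> chart R G)
    (a b : R) (g : R -> G) (h : R -> R -> G) : Prop :=
  exists2 d : R, 0 < d &
    [/\ smooth_surface A (`]- d, d[ `*` `]a - d, b + d[) h,
        (forall t, t \in `[a, b] -> h 0 t = g t)
      & (forall s, s \in `]- d, d[ -> h s a = g a /\ h s b = g b)].

Definition geodesic {R : realType} {G : groupType} {I : Type} (A : I -> chart R G)
    (p : chart R G) (ip : chart_model p -> chart_model p -> R)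
    (a b : R) (g : R -> G) : Prop :=
  forall h : R -> R -> G, variation A a b g h ->
    is_derive (0 : R) (1 : R) (fun s => energy ip a b (h s)) (0 : R).

(* Main.v *)
Require Import Defs.
From HB Require Import structures.
From mathcomp Require Import all_boot all_order all_algebra.
From mathcomp Require Import all_classical all_reals all_analysis.
From mathcomp Require Import zify ring lra.
Import Order.TTheory GRing.Theory Num.Theory.
Import numFieldNormedType.Exports.
Set Implicit Arguments.
Unset Strict Implicit.
Unset Printing Implicit Defensive.
Local Open Scope classical_set_scope.
Local Open Scope ring_scope.

(** The energy is E = 1/2 int <u,u>.  For a variation h(s,t) of g let u and v be
    the right logarithmic derivatives of h in t and in s.  The Maurer-Cartan
    equation u_s = v_t - ad(u) v ([maurer_cartan]) and an integration by parts
    give the first variation (lemma [is_derive_energy])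

      dE/ds = int <u_s, u> = int <v_t, u> - <v, ad(u)^T u>
            = - int <v, u_t + ad(u)^T u>,

    since v vanishes at the endpoints.  So the Euler equation implies that g is
    critical.  Conversely, the variation h(s,t) = c(s psi(t)) g(t), where
    c is a straight line through e in the chart with direction w, has
    v(0,t) = psi(t) w ([exists_variation]).  With kappa = <w, u_t + ad(u)^T u> and
    psi = kappa (t - a) (b - t), criticality says that the integral of
    kappa^2 (t - a) (b - t) vanishes; hence kappa = 0 for every w, and
    definiteness of < , > gives the Euler equation.

    All of this differentiates functions of two parameters about which it is only
    known that they are smooth along smooth curves of the plane.  The analytic
    core is therefore Boman's theorem in the form [smooth_partial]: for a scalar
    f of this kind, t |-> d/dr f(t,r) at r = 0 is smooth.  It rests on three facts.
    A sequence that converges fast enough lies on a smooth curve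
    ([special_curve]); hence all pure partial derivatives are locally bounded
    ([near2_iter_bounded]).  Landau's inequality bounds derivatives of
    intermediate order by the function and a derivative of high order
    ([landau_inequality]); hence the difference quotients of f in r, which
    converge uniformly, converge together with all their t-derivatives.

    For functions with values in a convenient vector space E the scalar theorem is
    enough: convenience says that a curve is smooth as soon as its images under
    continuous functionals are ([smooth_partialE]).  Identities between vectors,
    such as the symmetry of second derivatives ([partial12]) or the chain rule
    ([tvs_derive_comp]), are tested against the functionals < ,w>.  These separate
    points and, although they are merely bounded, commute with differentiation of
    smooth curves, because the second-order Taylor remainders of a smooth curve
    form a bounded set ([vN_bounded_remainder], [is_derive_ip]). *)

(** * Smooth curves in locally convex spaces *)

Section curves.
Context {R : realType}.
Implicit Types (E : tvsType R) (J : set R).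

Lemma near_shift (t : R) (P : R -> Prop) :
  (\forall s \near t, P s) -> \forall h \near 0^', P (h + t).
Proof.
move=> Pt; apply: nbhs_dnbhs.
have := @cvgD _ R^o _ _ _ id (cst t) 0 t cvg_id (cvg_cst _).
by rewrite add0r; apply.
Qed.

Lemma tvs_is_derive_near E (c d : R -> E) (t : R) (v : E) :
  (\forall s \near t, c s = d s) -> tvs_is_derive c t v -> tvs_is_derive d t v.
Proof.
move=> cd; apply: cvg_trans; apply: near_eq_cvg.
have cdt := nbhs_singleton cd.
by apply: filterS (near_shift cd) => h ch; rewrite ch cdt.
Qed.

Lemma tvs_derive_near E (c d : R -> E) (t : R) :
  (\forall s \near t, c s = d s) -> tvs_derive c t = tvs_derive d t.
Proof.
move=> cd; rewrite /tvs_derive; congr xget; apply/seteqP; split => v /=.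
  exact: tvs_is_derive_near.
by apply: tvs_is_derive_near; apply: filterS cd => s ->.
Qed.

Lemma tvs_is_derive_unique E (c : R -> E) (t : R) (v w : E) :
  hausdorff_space E -> tvs_is_derive c t v -> tvs_is_derive c t w -> v = w.
Proof. by move=> hE; exact: cvg_unique. Qed.

Lemma tvs_is_derive_val E (c : R -> E) (t : R) (v : E) :
  hausdorff_space E -> tvs_is_derive c t v -> tvs_derive c t = v.
Proof.
move=> hE cv; apply: (tvs_is_derive_unique hE _ cv).
by rewrite /tvs_derive; case: xgetP => [x _ //|/(_ v)].
Qed.

Lemma tvs_derivableP E (c : R -> E) (t : R) :
  tvs_derivable c t -> tvs_is_derive c t (tvs_derive c t).
Proof.
by move=> [v cv]; by rewrite /tvs_derive; case: xgetP => [x _ //|/(_ v)].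
Qed.

Lemma tvs_is_derive_shift E (c : R -> E) (t k : R) (v : E) :
  tvs_is_derive (fun r => c (r + k)) t v <-> tvs_is_derive c (t + k) v.
Proof.
by rewrite /tvs_is_derive; under eq_fun do rewrite -addrA.
Qed.

Lemma tvs_derive_shift E (c : R -> E) (t k : R) :
  tvs_derive (fun r => c (r + k)) t = tvs_derive c (t + k).
Proof.
rewrite /tvs_derive; congr xget; apply/seteqP.
by split => v /=; rewrite tvs_is_derive_shift.
Qed.

(** n-fold differentiability on J with the derivatives as witnesses: closure under
    sums, products and composition becomes an induction on n. *)
Fixpoint Ck {E} (n : nat) J (c : R -> E) : Prop :=
  if n is m.+1 then
    exists c' : R -> E, (forall t, J t -> tvs_is_derive c t (c' t)) /\ Ck m J c'
  else True.

Lemma Ck_ext E n J (c d : R -> E) : open J -> {in J, c =1 d} ->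
  Ck n J c -> Ck n J d.
Proof.
case: n => // n oJ cd [c' [cc' Cc']]; exists c'; split => // t Jt.
apply: tvs_is_derive_near (cc' _ Jt).
by apply: filterS (open_nbhs_nbhs (conj oJ Jt)) => s Js; apply: cd; rewrite inE.
Qed.

Lemma Ck_leq E n m J (c : R -> E) : (m <= n)%N -> Ck n J c -> Ck m J c.
Proof.
elim: n m c => [|n IH] [|m] c //=.
by rewrite ltnS => mn [c' [cc' Cc']]; exists c'; split => //; exact: IH Cc'.
Qed.

Lemma smooth_on_derive E J (c : R -> E) : smooth_on J c ->
  smooth_on J (tvs_derive c).
Proof. by move=> sc n t Jt; have := sc n.+1 t Jt; rewrite iterSr. Qed.

Lemma smooth_on_is_derive E J (c : R -> E) t : smooth_on J c -> J t ->
  tvs_is_derive c t (tvs_derive c t).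
Proof. by move=> sc Jt; apply: tvs_derivableP; exact: (sc 0%N). Qed.

Lemma smooth_onP E J (c : R -> E) : hausdorff_space E -> open J ->
  smooth_on J c <-> forall n, Ck n J c.
Proof.
move=> hE oJ; split.
  move=> + n; elim: n c => //= n IH c sc; exists (tvs_derive c); split.
    by move=> t; exact: smooth_on_is_derive.
  exact/IH/smooth_on_derive.
move=> + n; elim: n c => [|n IH] c Cc t Jt.
  by have [c' [cc' _]] := Cc 1%N; exists (c' t); exact: cc'.
rewrite iterSr; apply: IH => // m.
have [c' [cc' Cc']] := Cc m.+1.
by apply: (Ck_ext oJ _ Cc') => s /[!inE] /cc' /(tvs_is_derive_val hE).
Qed.

Lemma smooth_on_sub E J J' (c : R -> E) : J' `<=` J -> smooth_on J c ->
  smooth_on J' c.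
Proof. by move=> J'J sc n t /J'J; exact: sc. Qed.

Lemma smooth_derive E (c : R -> E) : smooth c -> smooth (tvs_derive c).
Proof. exact: smooth_on_derive. Qed.

Lemma smooth_is_derive E (c : R -> E) t : smooth c ->
  tvs_is_derive c t (tvs_derive c t).
Proof. by move=> sc; exact: smooth_on_is_derive sc _. Qed.

Lemma iter_derive_near E n (c d : R -> E) (t : R) :
  (\forall s \near t, c s = d s) ->
  \forall s \near t, iter n tvs_derive c s = iter n tvs_derive d s.
Proof.
elim: n => //= n IH /IH/nbhs_interior.
by apply: filterS => s /tvs_derive_near.
Qed.

(** Iterated derivatives at a point depend only on the germ of the curve there, so
    it suffices to find a globally smooth representative of every germ. *)
Lemma smooth_on_local E J (c : R -> E) :
  (forall t, J t -> exists d, smooth d /\ \forall s \near t, c s = d s) ->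
  smooth_on J c.
Proof.
move=> loc n t /loc [d [sd /(iter_derive_near n) cd]].
exists (tvs_derive (iter n tvs_derive d) t).
apply: (@tvs_is_derive_near _ (iter n tvs_derive d)).
  by apply: filterS cd => s ->.
exact/tvs_derivableP/(sd n).
Qed.

End curves.

(** * Smooth functions of one real variable *)

Section scalar_smooth.
Context {R : realType}.
Implicit Types (f g : R -> R) (J : set R) (t m r : R).

Lemma hausdorffR : hausdorff_space R.
Proof. exact: (@norm_hausdorff R R^o). Qed.

Lemma tvs_is_deriveR f (t v : R) : tvs_is_derive f t v <-> is_derive t 1 f v.
Proof.
have e : (fun h : R => h^-1 *: (f (h + t) - f t)) =
         (fun h : R => h^-1 *: ((f \o shift t) (h *: (1 : R)) - f t)).
  by apply: funext => h /=; rewrite [h *: _]mulr1.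
rewrite /tvs_is_derive e; split => [H|[/cvg_ex [l Hl] <-]].
  by apply: DeriveDef; [apply/cvg_ex; exists v|exact: cvg_lim H].
by rewrite /derive (cvg_lim _ Hl).
Qed.

Lemma scaleRE (x y : R) : x *: y = x * y.
Proof. by []. Qed.

Lemma Ck_cst n J (a : R) : Ck n J (fun=> a).
Proof.
elim: n a => //= n IH a; exists (fun=> 0); split => // t _.
by apply/tvs_is_deriveR; exact: is_derive_cst.
Qed.

Lemma Ck_id n J : Ck n J (fun t : R => t).
Proof.
case: n => //= n; exists (fun=> 1); split; last exact: Ck_cst.
by move=> t _; apply/tvs_is_deriveR; exact: is_derive_id.
Qed.

Lemma CkD n J f g : Ck n J f -> Ck n J g -> Ck n J (fun t => f t + g t).
Proof.
elim: n f g => //= n IH f g [f' [ff' Cf']] [g' [gg' Cg']].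
exists (fun t => f' t + g' t); split; last exact: IH.
move=> t Jt; apply/tvs_is_deriveR; apply: is_deriveD; apply/tvs_is_deriveR.
  exact: ff'.
exact: gg'.
Qed.

Lemma CkM n J f g : Ck n J f -> Ck n J g -> Ck n J (fun t => f t * g t).
Proof.
elim: n f g => //= n IH f g [f' [ff' Cf']] [g' [gg' Cg']].
exists (fun t => f t * g' t + g t * f' t); split; last first.
  apply: CkD; apply: IH => //.
    by apply: (@Ck_leq _ _ n.+1) => //; exists f'.
  by apply: (@Ck_leq _ _ n.+1) => //; exists g'.
move=> t Jt; apply/tvs_is_deriveR; apply: is_deriveM; apply/tvs_is_deriveR.
  exact: ff'.
exact: gg'.
Qed.

Lemma CkZ n J (a : R) f : Ck n J f -> Ck n J (fun t => a * f t).
Proof. by move=> Cf; apply: CkM => //; exact: Ck_cst. Qed.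

Lemma CkN n J f : Ck n J f -> Ck n J (fun t => - f t).
Proof.
by move=> Cf; under eq_fun do rewrite -mulN1r; exact: CkZ.
Qed.

Lemma CkB n J f g : Ck n J f -> Ck n J g -> Ck n J (fun t => f t - g t).
Proof. by move=> Cf Cg; apply: CkD => //; exact: CkN. Qed.

Lemma CkX n J f k : Ck n J f -> Ck n J (fun t => f t ^+ k).
Proof.
move=> Cf; elim: k => [|k IH]; first exact: Ck_cst.
by under eq_fun do rewrite exprS; exact: CkM.
Qed.

Lemma Ck_comp n J J' f g : (forall t, J t -> J' (g t)) ->
  Ck n J' f -> Ck n J g -> Ck n J (fun t => f (g t)).
Proof.
move=> JJ'; elim: n f g JJ' => //= n IH f g JJ' [f' [ff' Cf']] [g' [gg' Cg']].
exists (fun t => f' (g t) * g' t); split; last first.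
  apply: CkM => //; apply: IH => //.
  by apply: (@Ck_leq _ _ n.+1) => //; exists g'.
move=> t Jt; apply/tvs_is_deriveR; apply: is_derive1_comp; apply/tvs_is_deriveR.
  exact/ff'/JJ'.
exact: gg'.
Qed.

Lemma CkV n J f : (forall t, J t -> f t != 0) ->
  Ck n J f -> Ck n J (fun t => (f t)^-1).
Proof.
move=> f0; elim: n => //= n IH [f' [ff' Cf']].
exists (fun t => - (((f t)^-1) ^+ 2) * f' t); split; last first.
  apply: CkM => //; apply: CkN; apply: CkX; apply: IH.
  by apply: (@Ck_leq _ _ n.+1) => //; exists f'.
move=> t Jt; apply/tvs_is_deriveR; rewrite exprVn.
by apply: is_deriveV; [exact: f0|exact/tvs_is_deriveR/ff'].
Qed.

Lemma smoothP f : smooth f <-> forall n, Ck n setT f.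
Proof. exact: (smooth_onP _ hausdorffR openT). Qed.

Lemma smooth_cst (a : R) : smooth (fun=> a : R).
Proof. by apply/smoothP => n; exact: Ck_cst. Qed.

Lemma smooth_id : smooth (fun t : R => t).
Proof. by apply/smoothP => n; exact: Ck_id. Qed.

Lemma smoothD f g : smooth f -> smooth g -> smooth (fun t => f t + g t).
Proof. by move=> /smoothP Cf /smoothP Cg; apply/smoothP => n; exact: CkD. Qed.

Lemma smoothM f g : smooth f -> smooth g -> smooth (fun t => f t * g t).
Proof. by move=> /smoothP Cf /smoothP Cg; apply/smoothP => n; exact: CkM. Qed.

Lemma smoothB f g : smooth f -> smooth g -> smooth (fun t => f t - g t).
Proof. by move=> /smoothP Cf /smoothP Cg; apply/smoothP => n; exact: CkB. Qed.

Lemma smoothX f k : smooth f -> smooth (fun t => f t ^+ k).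
Proof. by move=> /smoothP Cf; apply/smoothP => n; exact: CkX. Qed.

Lemma smoothV f : (forall t, f t != 0) -> smooth f -> smooth (fun t => (f t)^-1).
Proof. by move=> f0 /smoothP Cf; apply/smoothP => n; exact: CkV. Qed.

Lemma smooth_on_comp J J' f g : open J -> open J' ->
  (forall t, J t -> J' (g t)) ->
  smooth_on J' f -> smooth_on J g -> smooth_on J (fun t => f (g t)).
Proof.
move=> oJ oJ' JJ' /(smooth_onP _ hausdorffR oJ') Cf.
move=> /(smooth_onP _ hausdorffR oJ) Cg.
by apply/(smooth_onP _ hausdorffR oJ) => n; apply: Ck_comp JJ' (Cf n) (Cg n).
Qed.

Lemma smooth_comp f g : smooth f -> smooth g -> smooth (fun t => f (g t)).
Proof. by apply: smooth_on_comp => //; exact: openT. Qed.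

Lemma smoothR_is_derive f t : smooth f -> is_derive t 1 f (tvs_derive f t).
Proof. by move=> sf; exact/tvs_is_deriveR/smooth_is_derive. Qed.

Lemma is_derive_tvs f t v : is_derive t 1 f v -> tvs_derive f t = v.
Proof. by move=> /tvs_is_deriveR; exact/tvs_is_derive_val/hausdorffR. Qed.

Lemma smooth_continuous f : smooth f -> continuous f.
Proof.
move=> sf t; apply: differentiable_continuous; apply/derivable1_diffP.
by have [] := smoothR_is_derive t sf.
Qed.

Lemma is_derive_nearR f g t (v : R) : (\forall s \near t, f s = g s) ->
  is_derive t 1 f v -> is_derive t 1 g v.
Proof.
move=> fg /tvs_is_deriveR df; apply/tvs_is_deriveR.
exact: tvs_is_derive_near df.
Qed.

Lemma is_derive_cstR (a t : R) : is_derive t 1 (fun=> a) 0.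
Proof. exact: is_derive_cst. Qed.

Lemma near_dist (t e : R) : 0 < e -> \forall s \near t, `|s - t| < e.
Proof.
move=> e0; have := nbhsx_ballx t _ e0; apply: filterS => s.
by rewrite -ball_normE /= distrC.
Qed.

Lemma near_dnbhs0 (d : R) : 0 < d -> \forall h \near (0 : R)^', `|h| < d.
Proof.
move=> d0; apply: nbhs_dnbhs; apply: filterS (near_dist (0 : R) d0) => h.
by rewrite subr0.
Qed.

(** ** Cutoffs *)

Lemma expR_ge_Xn (k : nat) (y : R) : 0 <= y -> y ^+ k <= k`!%:R * expR y.
Proof.
case: k => [|k] y0; first by rewrite expr0 mul1r -expR0 ler_expR.
rewrite mulrC -ler_pdivrMr ?ltr0n ?fact_gt0//.
by apply: le_trans (expR_ge1Dxn k y0); rewrite lerDr.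
Qed.

(** exp(-1/t) divided by t^n, extended by 0 to t <= 0.  The powers of t are carried
    along because the derivative of flat n is a combination of flat n.+1 and
    flat n.+2; so one induction on the order of differentiability treats all n. *)
Definition flat (n : nat) (t : R) : R :=
  if 0 < t then t ^- n * expR (- t^-1) else 0.

Lemma flat_bound n t : `|flat n t| <= n.+2`!%:R * t ^+ 2.
Proof.
rewrite /flat; case: ifPn => t0; last first.
  by rewrite normr0 mulr_ge0// ?sqr_ge0.
have ti : 0 <= t^-1 by rewrite invr_ge0 ltW.
rewrite ger0_norm; last by rewrite mulr_ge0 ?expR_ge0// invr_ge0 exprn_ge0// ltW.
have := expR_ge_Xn n.+2 ti; rewrite -ler_pdivrMr ?expR_gt0// -expRN => H.
rewrite -ler_pdivrMr ?exprn_gt0//; apply: le_trans H.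
by rewrite exprVn !exprS !invfM; nra.
Qed.

Lemma is_derive_powR n t :
  is_derive t 1 (fun s : R => s ^+ n) (n%:R * t ^+ n.-1).
Proof.
have -> : (fun s : R => s ^+ n) = (id : R -> R) ^+ n.
  by apply/funext => s; rewrite exprfctE.
apply: (is_derive_eq (is_deriveX n (is_derive_id t 1))).
by rewrite [_ *: 1]mulr1.
Qed.

Lemma is_derive_flat n t :
  is_derive t 1 (flat n) (flat n.+2 t - n%:R * flat n.+1 t).
Proof.
have [t0|t0|->] := ltgtP t 0.
- have -> : flat n.+2 t - n%:R * flat n.+1 t = 0.
    by rewrite /flat ltNge (ltW t0)/= mulr0 subr0.
  apply: (is_derive_nearR _ (is_derive_cstR 0 t)).
  by near=> s; rewrite /flat ltNge ltW//; near: s; exact: lt_nbhsl.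
- have -> : flat n.+2 t - n%:R * flat n.+1 t =
            t ^- n.+2 * expR (- t^-1) - n%:R * (t ^- n.+1 * expR (- t^-1)).
    by rewrite /flat t0.
  suff : is_derive t 1 (fun s => (s ^+ n)^-1 * expR (- s^-1))
      (t ^- n.+2 * expR (- t^-1) - n%:R * (t ^- n.+1 * expR (- t^-1))).
    apply: is_derive_nearR.
    by near=> s; rewrite /flat ifT//; near: s; exact: lt_nbhsr.
  have tn0 : t ^+ n != 0 by rewrite expf_neq0// gt_eqF.
  have d1 : is_derive t 1 (fun s : R => (s ^+ n)^-1)
     (- (t ^+ n) ^- 2 *: (n%:R * t ^+ n.-1)).
    by apply: is_deriveV => //; exact: is_derive_powR.
  have d2 : is_derive t 1 (fun s : R => expR (- s^-1)) (expR (- t^-1) * t ^- 2).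
    apply: is_derive1_comp; apply: (is_derive_eq (is_deriveN
      (is_deriveV (lt0r_neq0 t0) (is_derive_id t 1)))).
    by rewrite [_ *: 1]mulr1 opprK.
  apply: (is_derive_eq (is_deriveM d1 d2)).
  rewrite !scaleRE.
  case: n tn0 {d1 d2} => [|n] tn0; first by field; rewrite gt_eqF.
  by rewrite !exprS /=; field; rewrite !gt_eqF// exprn_gt0.
(* at 0, the quadratic bound makes the difference quotient tend to 0 *)
have -> : flat n.+2 0 - n%:R * flat n.+1 0 = 0 :> R.
  by rewrite /flat ltxx mulr0 subrr.
apply/tvs_is_deriveR; rewrite /tvs_is_derive.
apply/cvgr0Pnorm_le => /= e e0.
near=> h; have h0 : h != 0 by near: h; exact: nbhs_dnbhs_neq.
rewrite /= addr0 [flat n 0]/flat ltxx subr0 scaleRE normrM normfV.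
rewrite ler_pdivrMl ?normr_gt0//; apply: le_trans (flat_bound n h) _.
rewrite -(real_normK (num_real h)) expr2 mulrA mulrC ler_pM2l ?normr_gt0//.
rewrite -ler_pdivlMl ?ltr0n ?fact_gt0//; near: h.
apply: nbhs_dnbhs; apply: (@pseudometric_normed_Zmodule.nbhs0_le _ R^o).
by rewrite mulr_gt0// invr_gt0 ltr0n fact_gt0.
Unshelve. all: by end_near. Qed.

Lemma Ck_flat k n J : Ck k J (flat n).
Proof.
elim: k n => //= k IH n; exists (fun t => flat n.+2 t - n%:R * flat n.+1 t).
split; last by apply: CkB => //; exact: CkZ.
by move=> t _; apply/tvs_is_deriveR; exact: is_derive_flat.
Qed.

Lemma smooth_flat n : smooth (flat n).
Proof. by apply/smoothP => k; exact: Ck_flat. Qed.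

Lemma flat0_gt0 t : 0 < t -> 0 < flat 0 t.
Proof. by move=> t0; rewrite /flat t0 expr0 invr1 mul1r expR_gt0. Qed.

Lemma flat0_ge0 t : 0 <= flat 0 t.
Proof. by rewrite /flat; case: ifP => // _; rewrite expr0 invr1 mul1r expR_ge0. Qed.

Lemma flat0_eq0 t : t <= 0 -> flat 0 t = 0.
Proof. by rewrite /flat ltNge => ->. Qed.

Definition smooth_step (t : R) : R := flat 0 t / (flat 0 t + flat 0 (1 - t)).

Lemma smooth_step_den t : 0 < flat 0 t + flat 0 (1 - t).
Proof.
have [t0|t0] := ltP 0 t; first by rewrite ltr_wpDr ?flat0_ge0 ?flat0_gt0.
by rewrite ltr_wpDl ?flat0_ge0// flat0_gt0//; lra.
Qed.

Lemma smooth_smooth_step : smooth smooth_step.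
Proof.
apply: smoothM; first exact: smooth_flat.
apply: smoothV => [t|]; first by rewrite gt_eqF ?smooth_step_den.
apply: smoothD; first exact: smooth_flat.
apply: (smooth_comp (smooth_flat 0)).
by apply: smoothB; [exact: smooth_cst|exact: smooth_id].
Qed.

Lemma smooth_step1 t : 1 <= t -> smooth_step t = 1.
Proof.
move=> t1; rewrite /smooth_step (@flat0_eq0 (1 - t)) ?subr_le0// addr0 divff//.
by rewrite gt_eqF// flat0_gt0// (lt_le_trans _ t1).
Qed.

Lemma smooth_step0 t : t <= 0 -> smooth_step t = 0.
Proof. by move=> t0; rewrite /smooth_step flat0_eq0// mul0r. Qed.

Lemma smooth_step_ge0 t : 0 <= smooth_step t.
Proof. by rewrite divr_ge0 ?flat0_ge0// ltW// smooth_step_den. Qed.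

Lemma smooth_step_le1 t : smooth_step t <= 1.
Proof. by rewrite ler_pdivrMr ?smooth_step_den// mul1r lerDl flat0_ge0. Qed.

(** Written in terms of t^2 because |t| is not smooth at 0. *)
Definition plateau (r1 r2 : R) (t : R) : R :=
  smooth_step ((r2 ^+ 2 - t ^+ 2) / (r2 ^+ 2 - r1 ^+ 2)).

Lemma smooth_plateau r1 r2 : smooth (plateau r1 r2).
Proof.
apply: (smooth_comp smooth_smooth_step); apply: smoothM; last exact: smooth_cst.
by apply: smoothB; [exact: smooth_cst|apply: smoothX; exact: smooth_id].
Qed.

Lemma plateau_ge0 r1 r2 t : 0 <= plateau r1 r2 t.
Proof. exact: smooth_step_ge0. Qed.

Lemma plateau_le1 r1 r2 t : plateau r1 r2 t <= 1.
Proof. exact: smooth_step_le1. Qed.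

Lemma plateau1 r1 r2 t : 0 <= r1 -> r1 < r2 -> `|t| <= r1 -> plateau r1 r2 t = 1.
Proof.
move=> r10 r12 tr; apply: smooth_step1.
have r2r1 : r1 ^+ 2 < r2 ^+ 2 by rewrite ltr_pXn2r ?nnegrE// ltW// (le_lt_trans r10).
rewrite ler_pdivlMr ?subr_gt0// mul1r lerD2l lerN2 -(real_normK (num_real t)).
by rewrite ler_pXn2r ?nnegrE.
Qed.

Lemma plateau0 r1 r2 t : 0 <= r1 -> r1 < r2 -> r2 <= `|t| -> plateau r1 r2 t = 0.
Proof.
move=> r10 r12 tr; apply: smooth_step0.
have r20 : 0 <= r2 by rewrite (le_trans r10)// ltW.
have r2r1 : r1 ^+ 2 < r2 ^+ 2 by rewrite ltr_pXn2r ?nnegrE.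
rewrite pmulr_lle0 ?invr_gt0 ?subr_gt0// subr_le0 -(real_normK (num_real t)).
by rewrite ler_pXn2r ?nnegrE.
Qed.

(** A smooth stand-in for the projection onto [m - r2, m + r2]: composing with it
    turns a function defined near m into one defined on the whole line. *)
Definition soft_clamp (m r1 r2 : R) (t : R) : R := m + (t - m) * plateau r1 r2 (t - m).

Lemma smooth_soft_clamp m r1 r2 : smooth (soft_clamp m r1 r2).
Proof.
have sm : smooth (fun t : R => t - m).
  by apply: smoothB; [exact: smooth_id|exact: smooth_cst].
apply: smoothD; first exact: smooth_cst.
by apply: smoothM => //; apply: (smooth_comp (smooth_plateau _ _)).
Qed.

Lemma soft_clamp_id m r1 r2 t : 0 <= r1 -> r1 < r2 -> `|t - m| <= r1 ->
  soft_clamp m r1 r2 t = t.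
Proof. by move=> *; rewrite /soft_clamp plateau1// mulr1 addrC subrK. Qed.

Lemma soft_clamp_out m r1 r2 t : 0 <= r1 -> r1 < r2 -> r2 <= `|t - m| ->
  soft_clamp m r1 r2 t = m.
Proof. by move=> *; rewrite /soft_clamp plateau0// mulr0 addr0. Qed.

Lemma soft_clamp_lt m r1 r2 t : 0 <= r1 -> r1 < r2 -> `|soft_clamp m r1 r2 t - m| < r2.
Proof.
move=> r10 r12; have r20 : 0 < r2 by exact: le_lt_trans r12.
have [r2t|tr2] := leP r2 `|t - m|.
  by rewrite soft_clamp_out// subrr normr0.
rewrite /soft_clamp [m + _]addrC addrK normrM (le_lt_trans _ tr2)//.
by rewrite ler_piMr// ger0_norm ?plateau_ge0 ?plateau_le1.
Qed.

Lemma exists_clamp t0 d : 0 < d -> exists f : R -> R,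
  [/\ smooth f, f t0 = t0, (forall t, `|f t - t0| < d) &
      \forall t \near t0, f t = t].
Proof.
move=> d0; exists (soft_clamp t0 (d / 2) d).
have h1 : 0 <= d / 2 by rewrite divr_ge0// ltW.
have h2 : d / 2 < d by lra.
have d2 : 0 < d / 2 by rewrite divr_gt0.
split.
- exact: smooth_soft_clamp.
- by rewrite soft_clamp_id// subrr normr0.
- by move=> t; exact: soft_clamp_lt.
- by apply: filterS (near_dist t0 d2) => t tt; rewrite soft_clamp_id// ltW.
Qed.

Lemma open_ball1 (J : set R) t0 : open J -> J t0 ->
  exists2 d, 0 < d & forall t, `|t - t0| < d -> J t.
Proof.
move=> oJ Jt; have /nbhs_ballP [d d0 Hd] := open_nbhs_nbhs (conj oJ Jt).
by exists d => // t tt; apply: Hd; rewrite -ball_normE /= distrC.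
Qed.

End scalar_smooth.

(** * Iterated derivatives of scalar functions *)

Section iterated.
Context {R : realType}.
Implicit Types (f g : R -> R) (t x y : R).

Lemma smooth_iter f n : smooth f -> smooth (iter n tvs_derive f).
Proof. by elim: n => //= n IH /IH; exact: smooth_derive. Qed.

Lemma tvs_deriveB f g : smooth f -> smooth g ->
  tvs_derive (fun t => f t - g t) = (fun t => tvs_derive f t - tvs_derive g t).
Proof.
move=> sf sg; apply/funext => t; apply: is_derive_tvs.
by apply: is_deriveB; exact: smoothR_is_derive.
Qed.

Lemma tvs_deriveD f g : smooth f -> smooth g ->
  tvs_derive (fun t => f t + g t) = (fun t => tvs_derive f t + tvs_derive g t).
Proof.
move=> sf sg; apply/funext => t; apply: is_derive_tvs.
by apply: is_deriveD; exact: smoothR_is_derive.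
Qed.

Lemma tvs_derive_affine f (a k b : R) : smooth f ->
  tvs_derive (fun t => a * f (k * (t - b))) =
  (fun t => a * k * tvs_derive f (k * (t - b))).
Proof.
move=> sf; apply/funext => t; apply: is_derive_tvs.
have d1 : is_derive t 1 (fun t : R => k * (t - b)) k.
  apply: is_derive_eq (is_deriveZ k (is_deriveB (is_derive_id t 1)
    (is_derive_cstR b t))) _.
  by rewrite subr0 scaleRE mulr1.
have d2 := @is_derive1_comp _ f (fun t => k * (t - b)) t _ _
  (smoothR_is_derive (k * (t - b)) sf) d1.
apply: is_derive_eq (is_deriveZ a d2) _.
by rewrite scaleRE; ring.
Qed.

Lemma iter_deriveB f g n : smooth f -> smooth g ->
  iter n tvs_derive (fun t => f t - g t) =
  (fun t => iter n tvs_derive f t - iter n tvs_derive g t).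
Proof.
move=> sf sg; elim: n => //= n ->; apply: tvs_deriveB; exact: smooth_iter.
Qed.

Lemma iter_deriveD f g n : smooth f -> smooth g ->
  iter n tvs_derive (fun t => f t + g t) =
  (fun t => iter n tvs_derive f t + iter n tvs_derive g t).
Proof.
move=> sf sg; elim: n => //= n ->; apply: tvs_deriveD; exact: smooth_iter.
Qed.

Lemma iter_derive_affine f (a k b : R) n : smooth f ->
  iter n tvs_derive (fun t => a * f (k * (t - b))) =
  (fun t => a * k ^+ n * iter n tvs_derive f (k * (t - b))).
Proof.
move=> sf; elim: n => /= [|n ->]; first by rewrite expr0 mulr1.
rewrite tvs_derive_affine; last exact: smooth_iter.
by apply/funext => t; rewrite exprSr mulrA.
Qed.

Lemma smooth_affine f (a k b : R) : smooth f ->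
  smooth (fun t => a * f (k * (t - b))).
Proof.
move=> sf; apply: smoothM; first exact: smooth_cst.
apply: smooth_comp => //; apply: smoothM; first exact: smooth_cst.
by apply: smoothB; [exact: smooth_id|exact: smooth_cst].
Qed.

Lemma iter_derive_cst n (a : R) t : (0 < n)%N ->
  iter n tvs_derive (fun=> a : R) t = 0.
Proof.
case: n => // n _; rewrite iterSr.
have -> : tvs_derive (fun=> a : R) = (fun=> 0 : R).
  by apply/funext => s; apply: is_derive_tvs; exact: is_derive_cstR.
elim: n t => // n IH t; rewrite iterSr.
have -> // : tvs_derive (fun=> 0 : R) = (fun=> 0 : R).
by apply/funext => s; apply: is_derive_tvs; exact: is_derive_cstR.
Qed.

(** ** Mean value estimates *)

Lemma mean_value f (f' : R -> R) x y :
  (forall t, is_derive t 1 f (f' t)) ->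
  exists2 c, `|c - x| <= `|y - x| & f y - f x = f' c * (y - x).
Proof.
move=> df; have cf A : {within A, continuous f}.
  apply: continuous_subspaceT => t; apply: differentiable_continuous.
  by apply/derivable1_diffP; have [] := df t.
have [xy|yx] := leP x y.
  have [c /[!in_itv]/= /andP[xc cy] e] :=
    @MVT_segment R f f' x y xy (fun t _ => df t) (cf _).
  by exists c => //; rewrite !ger0_norm ?subr_ge0// lerB.
have [c /[!in_itv]/= /andP[yc cx] e] :=
  @MVT_segment R f f' y x (ltW yx) (fun t _ => df t) (cf _).
exists c; last by rewrite -[LHS]opprB e -mulrN opprB.
by rewrite ![`|_ - x|]distrC !ger0_norm ?subr_ge0// ?lerB// ltW.
Qed.

Lemma mean_value_le f (f' : R -> R) (M : R) x y :
  (forall t, is_derive t 1 f (f' t)) ->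
  (forall t, `|t - x| <= `|y - x| -> `|f' t| <= M) ->
  `|f y - f x| <= M * `|y - x|.
Proof.
move=> df fM; have [c cxy ->] := mean_value x y df.
by rewrite normrM ler_wpM2r// fM.
Qed.

Lemma taylor1 f (M : R) x y : smooth f ->
  (forall t, `|t - x| <= `|y - x| -> `|tvs_derive (tvs_derive f) t| <= M) ->
  `|f y - f x - (y - x) * tvs_derive f x| <= M * `|y - x| ^+ 2.
Proof.
move=> sf fM.
have dg t : is_derive t 1 (fun s => f s - s * tvs_derive f x)
    (tvs_derive f t - tvs_derive f x).
  apply: is_derive_eq (is_deriveB (smoothR_is_derive t sf)
    (is_deriveM (is_derive_id t 1) (is_derive_cstR (tvs_derive f x) t))) _.
  by rewrite /= !scaleRE mulr0 add0r mulr1.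
have -> : f y - f x - (y - x) * tvs_derive f x =
   (f y - y * tvs_derive f x) - (f x - x * tvs_derive f x) by ring.
apply: (le_trans (mean_value_le (M := M * `|y - x|) dg _)).
  move=> t txy.
  apply: le_trans (mean_value_le (M := M) _ _) _.
  - by move=> s; exact/smoothR_is_derive/smooth_derive.
  - by move=> s sx; apply: fM; exact: le_trans txy.
  - apply: ler_wpM2l => //; apply: le_trans (fM x _); rewrite ?normr_ge0//.
    by rewrite subrr normr0.
by rewrite -mulrA -expr2.
Qed.

(** ** Uniform limits of smooth functions *)

Lemma geometric_cauchy (u : nat -> R) (C : R) :
  (forall n, `|u n.+1 - u n| <= C * 2 ^- n) ->
  forall n k, `|u (n + k)%N - u n| <= 2 * C * 2 ^- n.
Proof.
move=> uC n k.
suff : `|u (n + k)%N - u n| <= 2 * C * (2 ^- n - 2 ^- (n + k)).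
  move=> /le_trans; apply; have C0 : 0 <= C.
    by have := le_trans (normr_ge0 _) (uC 0%N); rewrite expr0 invr1 mulr1.
  by rewrite ler_wpM2l ?mulr_ge0// gerBl invr_ge0 exprn_ge0.
elim: k => [|k IH]; first by rewrite addn0 !subrr normr0 mulr0.
rewrite -(subrKA (u (n + k)%N)).
apply: le_trans (ler_normD _ _) _.
rewrite addnS; apply: le_trans (lerD (uC _) IH) _.
rewrite (exprS _ (n + k)%N) invfM le_eqVlt; apply/orP; left; apply/eqP; field.
by rewrite !expf_neq0.
Qed.

Lemma le_dist_lim (u : nat -> R) (l a M : R) (n : nat) :
  u k @[k --> \oo] --> l -> (forall k, `|u (n + k)%N - a| <= M) ->
  `|l - a| <= M.
Proof.
move=> ul uM; rewrite leNgt; apply/negP => Ml.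
have e0 : 0 < `|l - a| - M by rewrite subr_gt0.
have [N _ /(_ (n + N)%N)] := @cvgr_dist_lt _ R^o _ _ _ _ _ ul _ e0.
rewrite /= leq_addl => /(_ isT) H.
have := ler_distD (u (n + N)%N) l a; have := uM N.
lra.
Qed.

Lemma pow2_small (C e : R) : 0 < e ->
  exists N, forall n, (N <= n)%N -> C * 2 ^- n < e.
Proof.
move=> e0; exists (Num.truncn (`|C| / e)).+1 => n Nn.
rewrite (le_lt_trans (ler_norm _))// normrM [X in _ * X]gtr0_norm ?invr_gt0 ?exprn_gt0//.
rewrite ltr_pdivrMr ?exprn_gt0// -ltr_pdivrMl// mulrC.
apply: (@lt_le_trans _ _ n%:R); last first.
  by rewrite -natrX ler_nat ltnW// ltn_expl.
by apply: (lt_le_trans (truncnS_gt _)); rewrite ler_nat.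
Qed.

Lemma geometric_cvg (u : nat -> R) (C : R) :
  (forall n, `|u n.+1 - u n| <= C * 2 ^- n) -> cvg (u n @[n --> \oo]).
Proof.
move=> uC; apply/(@cauchy_cvgP R^o)/cauchy_exP => e e0.
have [N CN] := pow2_small (2 * C) e0.
exists (u N); exists N => // n /= Nn; rewrite -ball_normE /= distrC.
rewrite -(subnKC Nn); apply: le_lt_trans (CN N _) => //.
exact: geometric_cauchy.
Qed.

Lemma smooth_continuousD f t (e : R) : smooth f -> 0 < e -> exists2 d, 0 < d &
  forall s, `|s - t| < d -> `|f s - f t| < e.
Proof.
move=> sf e0; have := @smooth_continuous _ f sf t.
move=> /(@cvgr_dist_lt _ R^o) /(_ _ e0); rewrite -filter_from_ballE => -[d d0 H].
exists d => // s std; rewrite distrC; apply: H.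
by rewrite -ball_normE /= distrC.
Qed.

(** The mean value theorem for f_m - f_n bounds the difference of their difference
    quotients by sup |f_m' - f_n'|; letting m tend to infinity, the difference
    quotients of the limit are close to those of f_n, uniformly in the increment. *)
Lemma is_derive_limit (f : nat -> R -> R) (g g' : R -> R) (C : R) :
  (forall n, smooth (f n)) ->
  (forall n t, `|tvs_derive (f n.+1) t - tvs_derive (f n) t| <= C * 2 ^- n) ->
  (forall t, f n t @[n --> \oo] --> g t) ->
  (forall t, tvs_derive (f n) t @[n --> \oo] --> g' t) ->
  forall t, is_derive t 1 g (g' t).
Proof.
move=> sf fC fg fg' t; apply/tvs_is_deriveR/cvgrPdist_le => /= e e0.
have e3 : 0 < e / 3 by rewrite divr_gt0.
have [N CN] := pow2_small (2 * C) e3.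
have fN := @smooth_is_derive _ _ _ t (sf N).
near=> h.
have h0 : h != 0 by near: h; exact: nbhs_dnbhs_neq.
have H1 : `|tvs_derive (f N) t - h^-1 * (f N (h + t) - f N t)| <= e / 3.
  by near: h; move/cvgrPdist_le : fN => /(_ _ e3).
have H2 : `|g' t - tvs_derive (f N) t| <= e / 3.
  apply: le_trans (ltW (CN N (leqnn _))).
  apply: (le_dist_lim (fg' t)) => k.
  exact: (geometric_cauchy (u := fun n => tvs_derive (f n) t)).
have H3 : `|(g (h + t) - g t) - (f N (h + t) - f N t)| <= e / 3 * `|h|.
  apply: (@le_dist_lim (fun n => f n (h + t) - f n t) _ _ _ N).
    by apply: (@cvgB _ R^o); exact: fg.
  move=> k.
  have -> : f (N + k)%N (h + t) - f (N + k)%N t - (f N (h + t) - f N t) =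
    (fun s => f (N + k)%N s - f N s) (h + t) - (fun s => f (N + k)%N s - f N s) t.
    by ring.
  have -> : `|h| = `|h + t - t| by rewrite addrK.
  apply: (@mean_value_le (fun s => f (N + k)%N s - f N s)
    (fun s => tvs_derive (f (N + k)%N) s - tvs_derive (f N) s)).
    by move=> s; apply: is_deriveB; exact: smoothR_is_derive.
  move=> s _; apply: le_trans (ltW (CN N (leqnn _))).
  exact: (geometric_cauchy (u := fun n => tvs_derive (f n) s)).
have {}H3 : `|h^-1 * (f N (h + t) - f N t) - h^-1 * (g (h + t) - g t)| <= e / 3.
  by rewrite -mulrBr normrM normfV distrC ler_pdivrMl ?normr_gt0// mulrC.
rewrite scaleRE.
have := ler_distD (tvs_derive (f N) t) (g' t) (h^-1 * (g (h + t) - g t)).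
have := ler_distD (h^-1 * (f N (h + t) - f N t)) (tvs_derive (f N) t)
  (h^-1 * (g (h + t) - g t)).
lra.
Unshelve. all: by end_near. Qed.

(** Only derivatives up to order k are controlled, so the approximating sequence may
    depend on k, as it does in [smooth_partial]. *)
Lemma Ck_limit k (f : nat -> R -> R) (g : R -> R) :
  (forall n, smooth (f n)) ->
  (forall j, (j <= k)%N -> exists C : R, forall n t,
    `|iter j tvs_derive (f n.+1) t - iter j tvs_derive (f n) t| <= C * 2 ^- n) ->
  (forall t, f n t @[n --> \oo] --> g t) ->
  Ck k setT g.
Proof.
elim: k f g => //= k IH f g sf fC fg.
have [C HC] := fC 1%N isT.
pose g' t : R := lim (tvs_derive (f n) t @[n --> \oo]).
have fg' t : tvs_derive (f n) t @[n --> \oo] --> g' t.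
  by apply: geometric_cvg => n; exact: HC.
exists g'; split.
  by move=> t _; apply/tvs_is_deriveR; exact: (is_derive_limit sf HC fg fg').
apply: (IH (fun n => tvs_derive (f n))) => //.
  by move=> n; exact: smooth_derive.
move=> j jk; have [D HD] := fC j.+1 jk; exists D => n t.
by rewrite -!iterSr; exact: HD.
Qed.

(** ** Landau's inequality *)

Definition bounded_derivatives f :=
  forall m, exists B : R, forall t, `|iter m tvs_derive f t| <= B.

(** Comparing f' with the slope of f over a step h gives
    sup |f'| <= 2 sup |f| / h + h sup |f''|.  The induction hypothesis for f' with
    the step 2 C h bounds h sup |f''| by sup |f'| / 2 plus a multiple of M h^(m+1),
    and the first term is absorbed on the left. *)
Lemma landau_inequality m : exists2 C : R, 1 <= C & forall f (e M h : R),
  smooth f -> bounded_derivatives f -> 0 < h ->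
  (forall t, `|f t| <= e) -> (forall t, `|iter m.+1 tvs_derive f t| <= M) ->
  forall t, `|tvs_derive f t| <= C * (e / h + M * h ^+ m).
Proof.
elim: m => [|m [C C1 IH]].
  exists 1 => // f e M h sf _ h0 fe fM t; rewrite mul1r expr0 mulr1.
  apply: le_trans (fM t) _; rewrite lerDr divr_ge0 ?(ltW h0)//.
  exact: le_trans (fe 0).
have C0 : 0 < C by exact: lt_le_trans C1.
exists (4 + 2 * C * (2 * C) ^+ m).
  have : 0 <= 2 * C * (2 * C) ^+ m by rewrite mulr_ge0 ?exprn_ge0 ?mulr_ge0// ltW.
  lra.
move=> f e M h sf bf h0 fe fM.
have [B HB] := bf 1%N.
pose S := [set `|tvs_derive f t| | t in setT].
have hS : has_sup S.
  split; first by exists `|tvs_derive f 0|, 0.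
  by exists B => _ [t _ <-]; exact: HB.
pose X := sup S.
have fX t : `|tvs_derive f t| <= X by apply: ub_le_sup; [case: hS|exists t].
have e0 : 0 <= e by exact: le_trans (fe 0).
have M0 : 0 <= M by exact: le_trans (fM 0).
have h'0 : 0 < 2 * C * h by rewrite !mulr_gt0.
have f''X t : `|tvs_derive (tvs_derive f) t| <=
    C * (X / (2 * C * h) + M * (2 * C * h) ^+ m).
  apply: IH => //; first exact: smooth_derive.
    by move=> j; have [B' HB'] := bf j.+1; exists B' => s; rewrite -iterSr.
  by move=> s; rewrite -iterSr.
have XX t : `|tvs_derive f t| <=
    2 * e / h + h * (C * (X / (2 * C * h) + M * (2 * C * h) ^+ m)).
  have [c cth Hc] := mean_value t (t + h) (fun s => smoothR_is_derive s sf).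
  rewrite [t + h]addrC addrK in Hc cth.
  have H1 : `|tvs_derive f c| <= 2 * e / h.
    rewrite ler_pdivlMr// -[X in _ * X]gtr0_norm// -normrM -Hc.
    rewrite (le_trans (ler_normB _ _))// mulr_natl mulr2n.
    by rewrite lerD.
  have H2 : `|tvs_derive f c - tvs_derive f t| <=
      h * (C * (X / (2 * C * h) + M * (2 * C * h) ^+ m)).
    apply: le_trans (mean_value_le
      (fun s => smoothR_is_derive s (smooth_derive sf)) (fun s _ => f''X s)) _.
    rewrite mulrC ler_wpM2r//.
      by apply: le_trans (f''X 0).
    by rewrite (le_trans cth)// gtr0_norm.
  have := ler_distD (tvs_derive f c) (tvs_derive f t) 0.
  by rewrite !subr0 [`|_ t - _|]distrC; lra.
have XE : h * (C * (X / (2 * C * h) + M * (2 * C * h) ^+ m)) =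
    X / 2 + C * (2 * C) ^+ m * (M * h ^+ m.+1).
  rewrite exprMn exprS; field; by rewrite !gt_eqF.
have X1 : X <= 2 * e / h + (X / 2 + C * (2 * C) ^+ m * (M * h ^+ m.+1)).
  by rewrite -XE; apply: ge_sup; [case: hS|move=> _ [t _ <-]].
move=> t; apply: le_trans (fX t) _.
have a0 : 0 <= e / h by rewrite divr_ge0// ltW.
have b0 : 0 <= M * h ^+ m.+1 by rewrite mulr_ge0// exprn_ge0// ltW.
have c0 : 0 <= C * (2 * C) ^+ m by rewrite mulr_ge0 ?exprn_ge0 ?mulr_ge0// ltW.
have : X <= 4 * (e / h) + 2 * (C * (2 * C) ^+ m) * (M * h ^+ m.+1).
  by move: X1; rewrite -mulrA; lra.
rewrite -(mulrA 2 C).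
move: (C * _) (e / h) (M * _) a0 b0 c0 => c a b a0 b0 c0.
have := mulr_ge0 c0 a0.
have := mulr_ge0 c0 b0; nra.
Qed.

End iterated.

(** * Sequences on smooth curves *)

Section boman.
Context {R : realType}.
Implicit Types (t r : R).

(** Write r for 2^-n.  If f_n = O(r^(A+1)) and every derivative is O(r^-K), then
    Landau's inequality with step r, applied to a derivative of order larger than
    K + A, loses a single power of r. *)
Lemma landau_decay (f : nat -> R -> R) (A K : nat) :
  (forall n, smooth (f n)) ->
  (exists C : R, forall n t, `|f n t| <= C * (2 ^- n) ^+ A.+1) ->
  (forall m, exists C : R, forall n t,
    `|iter m tvs_derive (f n) t| <= C * (2 ^+ n) ^+ K) ->
  exists C : R, forall n t, `|tvs_derive (f n) t| <= C * (2 ^- n) ^+ A.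
Proof.
move=> sf [C HC] fK; have [L L1 HL] := @landau_inequality R (K + A).
have [D HD] := fK (K + A).+1.
exists (L * (C + D)) => n t.
have n0 : 0 < 2 ^- n :> R by rewrite invr_gt0 exprn_gt0.
apply: le_trans (HL (f n) _ _ _ (sf n) _ n0 (HC n) (HD n) t) _.
  by move=> m; have [B HB] := fK m; exists (B * (2 ^+ n) ^+ K).
rewrite -[leRHS]mulrA; apply: ler_wpM2l; first exact: le_trans L1.
rewrite exprSr mulrA mulfK ?gt_eqF// exprD mulrA -(mulrA D) -exprMn.
by rewrite mulfV ?expf_neq0// expr1n mulr1 mulrDl.
Qed.

Lemma landau_decay_iter (f : nat -> R -> R) (A K j : nat) : (j <= A)%N ->
  (forall n, smooth (f n)) ->
  (exists C : R, forall n t, `|f n t| <= C * (2 ^- n) ^+ A) ->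
  (forall m, exists C : R, forall n t,
    `|iter m tvs_derive (f n) t| <= C * (2 ^+ n) ^+ K) ->
  exists C : R, forall n t, `|iter j tvs_derive (f n) t| <= C * (2 ^- n) ^+ (A - j).
Proof.
elim: j A f => [A f _ _ fA _|j IH [//|A] f]; first by rewrite subn0.
rewrite ltnS => jA sf fA fK.
have [C HC] := landau_decay sf fA fK.
have [|||D HD] := IH A (fun n => tvs_derive (f n)) jA.
- by move=> n; exact: smooth_derive.
- by exists C.
- move=> m; have [D HD] := fK m.+1; exists D => n t.
  by rewrite -iterSr; exact: HD.
- by exists D => n t; rewrite iterSr subSS; exact: HD.
Qed.

Lemma bounded_derivatives_support (g : R -> R) : smooth g ->
  (forall t, 1 <= `|t| -> g t = 0) -> bounded_derivatives g.
Proof.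
move=> sg g0 m; have sgm := smooth_iter m sg.
have cg : {within `[(-1)%R, 1%R], continuous (fun t => `|iter m tvs_derive g t|)}.
  apply: continuous_subspaceT => t; apply: (@cvg_norm _ R^o).
  exact: (@smooth_continuous _ _ sgm t).
have [|c _ Hc] := @EVT_max R (fun t => `|iter m tvs_derive g t|) (-1) 1 _ cg.
  lra.
exists `|iter m tvs_derive g c| => t.
have [t1|t1] := leP `|t| 1.
  by apply: Hc; rewrite in_itv/= -ler_norml.
have H : \forall s \near t, g s = 0.
  have t0 : 0 < `|t| - 1 by rewrite subr_gt0.
  apply: filterS (near_dist t t0) => s ts; apply: g0.
  by have := lerB_dist t s; rewrite distrC; lra.
have /nbhs_singleton -> := iter_derive_near m H.
case: m {sgm cg Hc} => [|m] /=; rewrite ?normr0//.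
by have /= -> := @iter_derive_cst R m.+1 0 t isT; rewrite normr0.
Qed.

(** 2^-(n^2) beats every power of 2^n: n (k + 1) - n^2 is bounded in n. *)
Lemma gaussian_decay (k : nat) : exists C : R, forall n : nat,
  2 ^- (n ^ 2) * (2 ^+ n.+2) ^+ k <= C * 2 ^- n.
Proof.
exists (2 ^+ (2 * k + (k.+1) ^ 2)) => n.
rewrite -exprM ler_pdivlMr ?exprn_gt0// -mulrA ler_pdivrMl ?exprn_gt0//.
rewrite -!exprD ler_eXn2l ?ltr1n//.
nia.
Qed.

(** The bumps sit at 2^-n, have width 2^-(n+2) and hence disjoint supports away
    from 0.  Rescaling costs a factor 2^((n+2) k) in the k-th derivative, which the
    amplitudes x_n absorb; so the series converges with all its derivatives. *)
Lemma bump_series (phi : R -> R) (x : nat -> R) : smooth phi ->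
  (forall t, 1 <= `|t| -> phi t = 0) -> (forall n, `|x n| <= 2 ^- (n ^ 2)) ->
  exists a : R -> R, [/\ smooth a, a 0 = 0 & forall n t,
    `|t - 2 ^- n| < 2 ^- n.+2 -> a t = x n * phi (2 ^+ n.+2 * (t - 2 ^- n))].
Proof.
move=> sphi phi0 x2.
pose term n t := x n * phi (2 ^+ n.+2 * (t - 2 ^- n)).
have sterm n : smooth (term n) by exact: smooth_affine.
pose f N t := \sum_(n < N) term n t.
have sf N : smooth (f N).
  elim: N => [|N IH].
    by rewrite /f; under eq_fun do rewrite big_ord0; exact: smooth_cst.
  by rewrite /f; under eq_fun do rewrite big_ord_recr/=; exact: smoothD.
have fS N : f N.+1 = (fun t => f N t + term N t).
  by apply/funext => t; rewrite /f big_ord_recr.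
have bphi := bounded_derivatives_support sphi phi0.
have fC j : exists C : R, forall n t,
    `|iter j tvs_derive (f n.+1) t - iter j tvs_derive (f n) t| <= C * 2 ^- n.
  have [B HB] := bphi j; have [C HC] := gaussian_decay j.
  exists (C * B) => n t; rewrite fS iter_deriveD// [X in `|X|]addrAC subrr add0r.
  rewrite iter_derive_affine// !normrM -(mulrAC C).
  apply: ler_pM => //.
  apply: le_trans (HC n); rewrite [X in _ * X]ger0_norm ?exprn_ge0//.
  by apply: ler_wpM2r; rewrite ?exprn_ge0.
pose a t : R := lim (f n t @[n --> \oo]).
have fa t : f n t @[n --> \oo] --> a t.
  by have [C HC] := fC 0%N; apply: (@geometric_cvg _ _ C) => n; exact: HC.
have stable t n : (forall m, (n <= m)%N -> term m t = 0) -> a t = f n t.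
  move=> tn; apply: (@cvg_lim R^o); first exact: hausdorffR.
  apply: cvg_near_cst; exists n => // m /= nm.
  rewrite -(subnKC nm); elim: (m - n)%N => [|d IH]; first by rewrite addn0.
  by rewrite addnS fS IH tn ?addr0// leq_addr.
have term0 n t : 2 ^- n.+2 <= `|t - 2 ^- n| -> term n t = 0.
  move=> tn; rewrite /term phi0 ?mulr0// normrM ger0_norm ?exprn_ge0//.
  by rewrite -ler_pdivrMl ?exprn_gt0// mulr1.
exists a; split.
- by apply/smoothP => k; apply: (Ck_limit sf).
- rewrite (stable 0 0%N) => [|m _]; first by rewrite /f big_ord0.
  apply: term0; rewrite sub0r normrN ger0_norm ?invr_ge0 ?exprn_ge0//.
  by rewrite lef_pV2 ?posrE ?exprn_gt0// ler_eXn2l ?ltr1n//; lia.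
- move=> n t tn.
  have far m : m != n -> term m t = 0.
    move=> mn; apply: term0; rewrite leNgt; apply/negP => tm.
    have p k : 0 < 2 ^- k :> R by rewrite invr_gt0 exprn_gt0.
    have q k : 2 ^- k.+2 = 2 ^- k / 4 :> R.
      by rewrite !exprS; field; rewrite expf_neq0.
    have h k l : (k < l)%N -> 2 ^- l <= 2 ^- k / 2 :> R.
      move=> kl; rewrite -invfM -exprSr lef_pV2 ?posrE ?exprn_gt0//.
      by rewrite ler_eXn2l// ?ltr1n.
    have := p n; have := p m; move: tm tn; rewrite !q !ltr_distl.
    by move: mn; rewrite neq_ltn => /orP[] /h; lra.
  rewrite (stable t n.+1) => [|m nm]; last by rewrite far// gtn_eqF.
  rewrite /f (bigD1 ord_max)//= big1 ?addr0// => i /eqP ni.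
  by apply: far; apply: contra_not_neq ni => ni; exact/val_inj.
Qed.

(** A smooth curve through a sequence that converges faster than any power of 2^-n:
    at time 2^-n it passes through x_n with velocity e_n, moving uniformly for a
    short time.  The numbers 2^-(n^2) are one choice of such a rate. *)
Lemma special_curve (x0 : R) (x e : nat -> R) :
  (forall n, `|x n - x0| <= 2 ^- (n ^ 2)) -> (forall n, `|e n| <= 2 ^- (n ^ 2)) ->
  exists a : R -> R, [/\ smooth a, a 0 = x0 & forall n,
    \forall t \near (2 ^- n : R), a t = x n + e n * (t - 2 ^- n)].
Proof.
move=> xx ee; pose chi := @plateau R (1 / 2) 1.
have schi : smooth chi by exact: smooth_plateau.
have h1 : (0 : R) <= 1 / 2 by lra.
have h2 : (1 / 2 : R) < 1 by lra.
have chi0 t : 1 <= `|t| -> chi t = 0 by move=> ?; exact: plateau0.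
have [|//|a [sa a0 Ha]] := @bump_series chi (fun n => x n - x0) schi.
  exact: chi0.
have [|||b [sb b0 Hb]] := @bump_series (fun t => t * chi t) (fun n => e n * 2 ^- n.+2).
- by apply: smoothM => //; exact: smooth_id.
- by move=> t t1; rewrite chi0// mulr0.
- move=> n; rewrite normrM -[leRHS]mulr1; apply: ler_pM => //.
  by rewrite ger0_norm ?invr_ge0 ?exprn_ge0// invf_le1 ?exprn_gt0// exprn_ege1// ler1n.
exists (fun t => x0 + (a t + b t)); split.
- apply: smoothD; first exact: smooth_cst.
  exact: smoothD.
- by rewrite a0 b0 !addr0.
move=> n; have p : 0 < 2 ^- n.+2 / 2 :> R by rewrite divr_gt0// invr_gt0 exprn_gt0.
near=> t.
have tn : `|t - 2 ^- n| < 2 ^- n.+2 / 2.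
  near: t; exact: near_dist.
have tn' : `|t - 2 ^- n| < 2 ^- n.+2 by lra.
have chi1 : chi (2 ^+ n.+2 * (t - 2 ^- n)) = 1.
  apply: plateau1 => //; rewrite normrM ger0_norm ?exprn_ge0//.
  by rewrite -ler_pdivlMl ?exprn_gt0// mul1r ltW.
rewrite (Ha n)// (Hb n)// chi1 !mulr1 mulrA -(mulrA (e n)) mulVf ?mulr1 ?expf_neq0//.
ring.
Unshelve. all: by end_near. Qed.

End boman.

(** * Boman's theorem in the plane *)

Definition smooth2 {R : realType} {E : tvsType R} (f : R -> R -> E) : Prop :=
  forall c d : R -> R, smooth c -> smooth d -> smooth (fun t => f (c t) (d t)).

Section smooth2.
Context {R : realType}.

Lemma smooth2_swap (E : tvsType R) (f : R -> R -> E) :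
  smooth2 f -> smooth2 (fun t r => f r t).
Proof. by move=> sf c d sc sd; exact: sf. Qed.

Lemma smooth2_1 (E : tvsType R) (f : R -> R -> E) r :
  smooth2 f -> smooth (fun t => f t r).
Proof. by move=> sf; apply: sf; [exact: smooth_id|exact: smooth_cst]. Qed.

Lemma smooth2_2 (E : tvsType R) (f : R -> R -> E) t : smooth2 f -> smooth (f t).
Proof. by move=> sf; apply: (sf (fun=> t)); [exact: smooth_cst|exact: smooth_id]. Qed.

Lemma smooth2_comp (E : tvsType R) (f : R -> R -> E) (c d : R -> R) :
  smooth2 f -> smooth c -> smooth d -> smooth2 (fun t r => f (c t) (d r)).
Proof.
by move=> sf sc sd c' d' sc' sd'; apply: sf; exact: smooth_comp.
Qed.

Definition near2 (t0 r0 : R) (P : R -> R -> Prop) : Prop :=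
  exists2 d : R, 0 < d & forall t r, `|t - t0| < d -> `|r - r0| < d -> P t r.

Lemma near2_and (t0 r0 : R) (P Q : R -> R -> Prop) :
  near2 t0 r0 P -> near2 t0 r0 Q -> near2 t0 r0 (fun t r => P t r /\ Q t r).
Proof.
move=> [d d0 Hd] [e e0 He]; exists (Num.min d e); first by rewrite lt_min d0.
by move=> t r; rewrite !lt_min => /andP[? ?] /andP[? ?]; split; [exact: Hd|exact: He].
Qed.

Lemma near2_sub (t0 r0 : R) (P Q : R -> R -> Prop) :
  (forall t r, P t r -> Q t r) -> near2 t0 r0 P -> near2 t0 r0 Q.
Proof. by move=> PQ [d d0 Hd]; exists d => // t r ? ?; apply/PQ/Hd. Qed.

Lemma near2_diag (P : R -> R -> Prop) : near2 0 0 P -> \forall s \near 0, P s s.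
Proof.
move=> [d d0 Hd]; apply: filterS (near_dist (0 : R) d0) => s sd; exact: Hd.
Qed.

Lemma near2_1 (P : R -> R -> Prop) : near2 0 0 P -> \forall s \near 0, P s 0.
Proof.
move=> [d d0 Hd]; apply: filterS (near_dist (0 : R) d0) => s sd; apply: Hd => //.
by rewrite subrr normr0.
Qed.

Lemma near2_2 (P : R -> R -> Prop) : near2 0 0 P -> \forall s \near 0, P 0 s.
Proof.
move=> [d d0 Hd]; apply: filterS (near_dist (0 : R) d0) => s sd; apply: Hd => //.
by rewrite subrr normr0.
Qed.

Lemma near2_product t0 r0 (P : R -> R -> Prop) (f g : R -> R) :
  (\forall t \near t0, f t = t) -> (\forall r \near r0, g r = r) ->
  near2 t0 r0 (fun t r => f t = t /\ g r = r).
Proof.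
move=> /nbhs_ballP [d d0 Hd] /nbhs_ballP [e e0 He].
exists (Num.min d e); first by rewrite lt_min; apply/andP.
move=> t r; rewrite !lt_min => /andP[td _] /andP[_ re].
by split; [apply: Hd|apply: He]; rewrite -ball_normE /= distrC.
Qed.

(** A property that fails arbitrarily near a point fails along a sequence that
    converges fast enough for [special_curve]. *)
Lemma near2_seq (t0 r0 : R) (P : nat -> R -> R -> Prop) :
  (forall n, ~ near2 t0 r0 (P n)) ->
  exists t r : nat -> R, forall n, [/\ `|t n - t0| <= 2 ^- (n ^ 2),
    `|r n - r0| <= 2 ^- (n ^ 2) & ~ P n (t n) (r n)].
Proof.
move=> nP; have H n : exists tr : R * R, [/\ `|tr.1 - t0| <= 2 ^- (n ^ 2),
    `|tr.2 - r0| <= 2 ^- (n ^ 2) & ~ P n tr.1 tr.2].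
  apply: contrapT => no; apply: (nP n).
  exists (2 ^- (n ^ 2)); first by rewrite invr_gt0 exprn_gt0.
  move=> t r tn rn; apply: contrapT => nPtr; apply: no.
  by exists (t, r); split => //=; exact: ltW.
have [tr Htr] := choice H.
by exists (fun n => (tr n).1), (fun n => (tr n).2) => n; exact: Htr.
Qed.

Lemma cvg_pow2 : (2 ^- n : R) @[n --> \oo] --> (0 : R).
Proof.
apply/(@cvgr0Pnorm_lt _ R^o) => e e0; have [N HN] := pow2_small 1 e0.
exists N => // n /= /HN; rewrite mul1r ger0_norm// invr_ge0 exprn_ge0//.
Qed.

(** Hence neighbourhoods in the plane can be tested along smooth curves. *)
Lemma near2_curve (t0 r0 : R) (P : R -> R -> Prop) :
  (forall a b : R -> R, smooth a -> smooth b -> a 0 = t0 -> b 0 = r0 ->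
    \forall s \near 0, P (a s) (b s)) -> near2 t0 r0 P.
Proof.
move=> curveP; apply: contrapT => nP.
have [t [r tr]] := @near2_seq t0 r0 (fun=> P) (fun=> nP).
have z n : `|0 : R| <= 2 ^- (n ^ 2) by rewrite normr0 invr_ge0 exprn_ge0.
have [|a [sa a0 Ha]] := @special_curve R t0 t (fun=> 0) _ z.
  by move=> n; have [] := tr n.
have [|b [sb b0 Hb]] := @special_curve R r0 r (fun=> 0) _ z.
  by move=> n; have [] := tr n.
have := curveP a b sa sb a0 b0 => /cvg_pow2 [N _ /(_ N (leqnn N))] /=.
have /nbhs_singleton -> := Ha N; have /nbhs_singleton -> := Hb N.
by rewrite !mul0r !addr0; have [] := tr N.
Qed.

(** If the m-th partial derivative were unbounded near (t0, r0), it would exceed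
    n 2^(n^2 m) at points (t_n, r_n) with distance 2^-(n^2) from (t0, r0).  Along a
    smooth curve that passes through (t_n, r_n) horizontally with speed 2^-(n^2), the
    m-th derivative of f would be larger than n at time 2^-n, although it is
    continuous at 0. *)
Lemma near2_iter_bounded (f : R -> R -> R) m t0 r0 : smooth2 f ->
  exists B : R, near2 t0 r0 (fun t r => `|iter m tvs_derive (f^~ r) t| <= B).
Proof.
move=> sf; apply: contrapT => noB.
have [|t [r tr]] := @near2_seq t0 r0 (fun n t r =>
    `|iter m tvs_derive (f^~ r) t| <= n%:R * (2 ^+ (n ^ 2)) ^+ m).
  by move=> n Bn; apply: noB; exists (n%:R * (2 ^+ (n ^ 2)) ^+ m).
have z n : `|0 : R| <= 2 ^- (n ^ 2) by rewrite normr0 invr_ge0 exprn_ge0.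
have [||a [sa a0 Ha]] := @special_curve R t0 t (fun n => 2 ^- (n ^ 2)) _ _.
- by move=> n; have [] := tr n.
- by move=> n; rewrite ger0_norm// invr_ge0 exprn_ge0.
have [|b [sb b0 Hb]] := @special_curve R r0 r (fun=> 0) _ z.
  by move=> n; have [] := tr n.
pose F s := f (a s) (b s).
have sF : smooth F by exact: sf.
(* near 2^-n the curve is affine, so f along it is an affine rescaling of f^~ (r n) *)
have aff (k u x s : R) : k != 0 -> u + k * (s - x) = k * (s - (x - u / k)).
  by move=> k0; field.
have Fn n : iter m tvs_derive F (2 ^- n) =
    (2 ^- (n ^ 2)) ^+ m * iter m tvs_derive (f^~ (r n)) (t n).
  pose k : R := 2 ^- (n ^ 2).
  have k0 : k != 0 by rewrite invr_eq0 expf_neq0.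
  have : \forall s \near (2 ^- n : R), F s =
      1 * f (k * (s - (2 ^- n - t n / k))) (r n).
    near=> s; rewrite /F mul1r.
    have -> : a s = t n + k * (s - 2 ^- n) by near: s; exact: Ha.
    have -> : b s = r n + 0 * (s - 2 ^- n) by near: s; exact: Hb.
    by rewrite mul0r addr0 aff.
  move=> /(iter_derive_near m)/nbhs_singleton ->.
  rewrite (@iter_derive_affine R (f^~ (r n))); last exact: smooth2_1.
  by rewrite mul1r -aff// subrr mulr0 addr0.
have cF := @smooth_continuous _ _ (smooth_iter m sF) 0.
have := cvg_comp _ _ cvg_pow2 cF => /cvgrPdist_lt /(_ 1 ltr01) [N _ HN].
pose n := maxn N (Num.truncn (`|iter m tvs_derive F 0| + 1)).+1.
have := HN n; rewrite /= leq_maxl => /(_ isT).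
rewrite Fn; have [_ _ /negP] := tr n; rewrite -ltNge.
have n0 : 0 < 2 ^+ (n ^ 2) :> R by rewrite exprn_gt0.
move: n0; set w : R := 2 ^+ (n ^ 2) => n0.
rewrite -ltr_pdivlMr ?exprn_gt0// mulrC -exprVn.
set y := iter m tvs_derive (f^~ (r n)) (t n).
have -> : w^-1 ^+ m * `|y| = `|w^-1 ^+ m * y|.
  by rewrite normrM ger0_norm// exprn_ge0// invr_ge0 ltW.
move: (_ ^+ m * y) => {}y ny Fy.
have := ler_distD (iter m tvs_derive F 0) y 0.
rewrite !subr0 distrC => H.
have : n%:R < `|iter m tvs_derive F 0| + 1 by lra.
apply/negP; rewrite -leNgt; apply: ltW; apply: (lt_le_trans (truncnS_gt _)).
by rewrite ler_nat leq_maxr.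
Unshelve. all: by end_near. Qed.

(** Compactness of the box. *)
Lemma box_bounded (g : R -> R -> R) (t0 t1 r0 r1 : R) :
  (forall t r, exists B : R, near2 t r (fun t r => `|g t r| <= B)) ->
  exists B : R, forall t r, t0 <= t <= t1 -> r0 <= r <= r1 -> `|g t r| <= B.
Proof.
move=> lb.
have K : compact (`[t0, t1] `*` `[r0, r1] : set (R * R)).
  by apply: compact_setX; exact: segment_compact.
have := (compact_near_coveringP _).1 K _ +oo%R (fun B p => `|g p.1 p.2| <= B) _.
case=> [[t r] _|B [_ HB]].
- have [B [d d0 HB]] := lb t r.
  exists (ball t d `*` ball r d, [set x | B <= x]) => /=.
    split; last by exists B; split; [exact: num_real|move=> x /ltW].
    by exists (ball t d, ball r d) => //; split; exact: nbhsx_ballx.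
  move=> [[t' r'] x] /= [[tt rr] Bx]; apply: le_trans Bx.
  by move: tt rr; rewrite -!ball_normE /= (distrC t) (distrC r); exact: HB.
exists (B + 1) => t r tt rr; apply: (HB (B + 1) _ (t, r)); first by rewrite ltrDl.
by split; rewrite /= in_itv.
Qed.

(** After clamping both variables the function is constant in t far from t0, so
    bounds on a box are global bounds, as Landau's inequality requires. *)
Lemma soft_clamp_bounded (f : R -> R -> R) (t0 r0 : R) m : smooth2 f ->
  exists B : R, forall t r, `|iter m tvs_derive
    (fun s => f (soft_clamp t0 (1 / 2) 1 s) (soft_clamp r0 (1 / 2) 1 r)) t| <= B.
Proof.
move=> sf; pose th := soft_clamp t0 (1 / 2) 1; pose rh := soft_clamp r0 (1 / 2) 1.
pose F t r := f (th t) (rh r).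
have sF : smooth2 F by apply: smooth2_comp => //; exact: smooth_soft_clamp.
have [B HB] := @box_bounded (fun t r => iter m tvs_derive (F^~ r) t)
  (t0 - 1) (t0 + 1) (r0 - 1) (r0 + 1) (fun t r => near2_iter_bounded m t r sF).
have h1 : (0 : R) <= 1 / 2 by lra.
have h2 : (1 / 2 : R) < 1 by lra.
have near_box (x y : R) : (`|x - y| <= 1) = (y - 1 <= x <= y + 1).
  by rewrite ler_distl.
have B0 : 0 <= B.
  by apply: le_trans (HB t0 r0 _ _); rewrite // -near_box subrr normr0 ler01.
exists B => t r; change (`|iter m tvs_derive (F^~ r) t| <= B).
wlog : r / `|r - r0| <= 1 => [wr|rr].
  have [/wr//|rr] := leP `|r - r0| 1.
  rewrite (_ : F^~ r = F^~ r0); first by apply: wr; rewrite subrr normr0 ler01.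
  apply/funext => s; rewrite /F /rh soft_clamp_out ?(ltW rr)// soft_clamp_id//.
  by rewrite subrr normr0.
have [tt|tt] := leP `|t - t0| 1; first by apply: HB; rewrite -near_box.
have : \forall s \near t, F s r = F t0 r.
  have tt0 : 0 < `|t - t0| - 1 by rewrite subr_gt0.
  apply: filterS (near_dist t tt0) => s ts.
  rewrite /F /th soft_clamp_out// ?soft_clamp_id// ?subrr ?normr0//.
  by have := ler_distD s t t0; rewrite (distrC t s); lra.
move=> /(iter_derive_near m)/nbhs_singleton ->.
case: m {sf sF} HB => [|m] HB; last by rewrite iter_derive_cst ?normr0.
by apply: (HB t0); rewrite -near_box// subrr normr0 ler01.
Qed.

(** The difference quotients q_n(t) = (F(t, rho_n) - F(t, 0)) / rho_n, with
    rho_n = 2^-n(k+1), converge to the partial derivative with error O(rho_n), since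
    the second r-derivative of F is bounded.  The t-derivatives of F are bounded, so
    those of q_n are O(1 / rho_n).  By Landau's inequality the derivatives of
    q_(n+1) - q_n up to order k are still O(2^-n), and the limit is k times
    differentiable. *)
Lemma smooth_partial (f : R -> R -> R) : smooth2 f ->
  smooth (fun t => tvs_derive (f t) 0).
Proof.
move=> sf; apply: smooth_on_local => t0 _.
pose th := soft_clamp t0 (1 / 2) 1; pose rh := @soft_clamp R 0 (1 / 2) 1.
pose F t r := f (th t) (rh r).
have sF : smooth2 F by apply: smooth2_comp => //; exact: smooth_soft_clamp.
have h0 : (0 : R) < 1 / 2 by lra.
have h1 : (0 : R) <= 1 / 2 by lra.
have h2 : (1 / 2 : R) < 1 by lra.
have rh0 : rh 0 = 0 by rewrite /rh soft_clamp_id// subrr normr0.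
exists (fun t => tvs_derive (F t) 0); split; last first.
  apply: filterS (near_dist t0 h0) => t tt.
  apply: tvs_derive_near; apply: filterS (near_dist 0 h0) => r rr.
  by rewrite /F /th /rh !soft_clamp_id// ltW.
apply/smoothP => k.
have [B HB] : exists B : R, forall t r, `|tvs_derive (tvs_derive (F t)) r| <= B.
  have [B HB] := @soft_clamp_bounded (fun r t => f t r) 0 t0 2 (smooth2_swap sf).
  by exists B => t r; exact: HB.
have B0 : 0 <= B by exact: le_trans (HB 0 0).
pose rho n : R := (2 ^- n) ^+ k.+1.
have rho0 n : 0 < rho n by rewrite exprn_gt0// invr_gt0 exprn_gt0.
have rhoS n : rho n.+1 <= rho n.
  rewrite /rho; apply: lerXn2r; rewrite ?nnegrE ?invr_ge0 ?exprn_ge0//.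
  by rewrite lef_pV2 ?posrE ?exprn_gt0// ler_eXn2l ?ltr1n.
pose q n t := (F t (rho n) - F t 0) / rho n.
have sq n : smooth (q n).
  apply: smoothM; last exact: smooth_cst.
  by apply: smoothB; exact: smooth2_1.
have qG n t : `|q n t - tvs_derive (F t) 0| <= B * rho n.
  have := @taylor1 R (F t) B 0 (rho n) (smooth2_2 t sF) (fun s _ => HB t s).
  rewrite !subr0 (ger0_norm (ltW (rho0 n))) expr2 mulrA -ler_pdivrMr//.
  rewrite -[X in _ / X]ger0_norm ?(ltW (rho0 n))// -normf_div.
  by rewrite mulrBl [X in _ - X]mulrAC mulfV ?gt_eqF// mul1r.
apply: (@Ck_limit _ _ q) => //; last first.
  move=> t; apply/cvgrPdist_le => /= e e0.
  have [N HN] := pow2_small B e0.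
  exists N => // n /= /HN/ltW; rewrite distrC; apply: le_trans.
  apply: le_trans (qG n t) _; rewrite ler_wpM2l// /rho exprS.
  rewrite ler_piMr// ?invr_ge0 ?exprn_ge0// exprn_ile1 ?invr_ge0 ?exprn_ge0//.
  by rewrite invf_le1 ?exprn_gt0// exprn_ege1// ler1n.
move=> j jk.
have [||||C HC] := @landau_decay_iter R (fun n t => q n.+1 t - q n t) k.+1 k.+1 j.
- exact: leq_trans jk _.
- by move=> n; exact: smoothB.
- exists (2 * B) => n t.
  have := ler_distD (tvs_derive (F t) 0) (q n.+1 t) (q n t).
  rewrite (distrC (tvs_derive (F t) 0)) => /le_trans; apply.
  apply: le_trans (lerD (qG n.+1 t) (qG n t)) _.
  have := ler_wpM2l B0 (rhoS n); rewrite -/(rho n); lra.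
- move=> m; have [D HD] := @soft_clamp_bounded f t0 0 m sf.
  have {}HD t r : `|iter m tvs_derive (F^~ r) t| <= D by exact: HD.
  have D0 : 0 <= D by exact: le_trans (HD 0 0).
  have Hq n t : `|iter m tvs_derive (q n) t| <= 2 * D / rho n.
    have -> : q n = (fun t => (rho n)^-1 * (fun s => F s (rho n) - F s 0) (1 * (t - 0))).
      by apply/funext => s; rewrite /q mul1r subr0 mulrC.
    rewrite (@iter_derive_affine R (fun s => F s (rho n) - F s 0)); last first.
      by apply: smoothB; exact: smooth2_1.
    rewrite expr1n mulr1 mul1r subr0 normrM gtr0_norm ?invr_gt0// mulrC.
    rewrite ler_wpM2r ?invr_ge0 ?(ltW (rho0 n))//.
    rewrite iter_deriveB; try exact: smooth2_1.
    apply: le_trans (ler_normB _ _) _.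
    by rewrite mulr_natl mulr2n; apply: lerD; exact: HD.
  have rhoV n : (rho n)^-1 = (2 ^+ n) ^+ k.+1 by rewrite /rho exprVn invrK.
  exists (2 * D * 2 ^+ k.+1 + 2 * D) => n t; rewrite iter_deriveB//.
  apply: le_trans (ler_normB _ _) _; rewrite mulrDl; apply: lerD.
    by apply: le_trans (Hq _ _) _; rewrite rhoV (exprS 2 n) exprMn mulrA.
  by apply: le_trans (Hq _ _) _; rewrite rhoV.
exists C => n t.
have -> : iter j tvs_derive (q n.+1) t - iter j tvs_derive (q n) t =
    iter j tvs_derive (fun s => q n.+1 s - q n s) t by rewrite iter_deriveB.
have C0 : 0 <= C.
  by have := le_trans (normr_ge0 _) (HC 0%N 0); rewrite expr0 invr1 expr1n mulr1.
apply: le_trans (HC n t) _; apply: ler_wpM2l => //.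
rewrite subSn// exprS ler_piMr// ?invr_ge0 ?exprn_ge0//.
rewrite exprn_ile1 ?invr_ge0 ?exprn_ge0//.
by rewrite invf_le1 ?exprn_gt0// exprn_ege1// ler1n.
Qed.

End smooth2.

(** * Partial derivatives and parameter integrals *)

Definition partial1 {R : realType} {E : tvsType R} (f : R -> R -> E) (t r : R) : E :=
  tvs_derive (fun s => f s r) t.

Definition partial2 {R : realType} {E : tvsType R} (f : R -> R -> E) (t r : R) : E :=
  tvs_derive (f t) r.

Section smooth2_scalar.
Context {R : realType}.
Implicit Types (f : R -> R -> R) (t r a b x c : R).
Local Notation mu := (@lebesgue_measure R).

(** Shifting the second variable along a curve reduces differentiation at an
    arbitrary point to differentiation at 0. *)
Lemma smooth2_d2_of (E : tvsType R) :
  (forall F : R -> R -> E, smooth2 F -> smooth (fun t => tvs_derive (F t) 0)) ->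
  forall F : R -> R -> E, smooth2 F -> smooth2 (partial2 F).
Proof.
move=> H F sF c d sc sd.
have -> : (fun t => partial2 F (c t) (d t)) =
    (fun t => tvs_derive (fun r => F (c t) (r + d t)) 0).
  by apply/funext => t; rewrite (tvs_derive_shift (F (c t))) add0r.
apply: (H (fun t r => F (c t) (r + d t))) => c' d' sc' sd'; apply: sF; first exact: smooth_comp.
by apply: smoothD => //; exact: smooth_comp.
Qed.

Lemma smooth2_d2 f : smooth2 f -> smooth2 (partial2 f).
Proof. by apply: smooth2_d2_of => F; exact: smooth_partial. Qed.

Lemma smooth2_d1 f : smooth2 f -> smooth2 (partial1 f).
Proof. by move=> /smooth2_swap/smooth2_d2/smooth2_swap. Qed.

Lemma smooth2_continuous f t0 r0 (e : R) : smooth2 f -> 0 < e ->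
  near2 t0 r0 (fun t r => `|f t r - f t0 r0| < e).
Proof.
move=> sf e0; apply: near2_curve => a b sa sb <- <-.
have [d d0 Hd] := smooth_continuousD 0 (sf _ _ sa sb) e0.
by apply: filterS (near_dist 0 d0) => s; exact: Hd.
Qed.

Lemma dist_half (e x u v : R) :
  `|x - u| < e / 2 -> `|x - v| < e / 2 -> `|u - v| <= e.
Proof.
by rewrite !ltr_norml ler_norml => /andP[? ?] /andP[? ?]; apply/andP; split; lra.
Qed.

(** The chain rule along the diagonal: f(t+h, t+h) - f(t, t+h) is h times a value of
    the first partial derivative near (t, t), which is continuous there. *)
Lemma is_derive_diag f t : smooth2 f ->
  is_derive t 1 (fun s => f s s) (partial1 f t t + partial2 f t t).
Proof.
move=> sf; apply/tvs_is_deriveR/cvgrPdist_le => /= e e0.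
have e2 : 0 < e / 2 by rewrite divr_gt0.
have [d d0 Hd] := smooth2_continuous t t (smooth2_d1 sf) e2.
have := @smooth_is_derive _ _ _ t (smooth2_2 t sf).
move=> /cvgrPdist_le /(_ _ e2) /= H.
near=> h.
have h0 : h != 0 by near: h; exact: nbhs_dnbhs_neq.
have hd : `|h| < d by near: h; exact: near_dnbhs0.
have H1 : `|tvs_derive (f t) t - h^-1 * (f t (h + t) - f t t)| <= e / 2.
  by near: h.
have [c ch Hc] := mean_value t (h + t)
  (fun s => smoothR_is_derive s (smooth2_1 (h + t) sf)).
rewrite addrK in ch Hc.
have H2 := Hd c (h + t) (le_lt_trans ch hd); rewrite addrK in H2.
have {}H2 := H2 hd.
rewrite scaleRE.
have -> : f (h + t) (h + t) - f t t =
    tvs_derive (f^~ (h + t)) c * h + (f t (h + t) - f t t).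
  by rewrite -Hc addrA subrK.
rewrite mulrDr (mulrCA h^-1) mulVf// mulr1.
rewrite /partial1 /partial2 in H2 *.
move: H1 H2; rewrite ler_norml ltr_norml => /andP[H1 H1'] /andP[H2 H2'].
by rewrite ler_norml; apply/andP; split; lra.
Unshelve. all: by end_near. Qed.

(** Both mixed derivatives, at suitable points, equal the second difference of f over
    a small square divided by its area. *)
Lemma d1_d2 f t r : smooth2 f -> partial1 (partial2 f) t r = partial2 (partial1 f) t r.
Proof.
move=> sf; apply/eqP; rewrite -subr_eq0 -normr_le0; apply/ler_addgt0Pl => e e0.
rewrite addr0.
have e2 : 0 < e / 2 by rewrite divr_gt0.
have [d d0 Hd] := smooth2_continuous t r (smooth2_d1 (smooth2_d2 sf)) e2.
have [d' d'0 Hd'] := smooth2_continuous t r (smooth2_d2 (smooth2_d1 sf)) e2.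
have [h h0 [hd hd']] : exists2 h : R, 0 < h & h < d /\ h < d'.
  have m0 : 0 < Num.min d d' by rewrite lt_min d0.
  have md : Num.min d d' <= d by rewrite ge_min lexx.
  have md' : Num.min d d' <= d' by rewrite ge_min lexx orbT.
  by exists (Num.min d d' / 2); [rewrite divr_gt0|split; lra].
have near_h x c : `|c - x| <= `|x + h - x| -> `|c - x| <= h.
  by rewrite addrAC subrr add0r (gtr0_norm h0).
have [x1 /near_h x1h E1] := @mean_value R (fun s => f s (r + h) - f s r) _ t (t + h)
  (fun s => is_deriveB (smoothR_is_derive s (smooth2_1 (r + h) sf))
                       (smoothR_is_derive s (smooth2_1 r sf))).
have [y1 /near_h y1h E2] := @mean_value R (partial1 f x1) _ r (r + h)
  (fun s => smoothR_is_derive s (smooth2_2 x1 (smooth2_d1 sf))).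
have [y2 /near_h y2h E3] := @mean_value R (fun s => f (t + h) s - f t s) _ r (r + h)
  (fun s => is_deriveB (smoothR_is_derive s (smooth2_2 (t + h) sf))
                       (smoothR_is_derive s (smooth2_2 t sf))).
have [x2 /near_h x2h E4] := @mean_value R (fun s => partial2 f s y2) _ t (t + h)
  (fun s => smoothR_is_derive s (smooth2_1 y2 (smooth2_d2 sf))).
have H1 := Hd _ _ (le_lt_trans x2h hd) (le_lt_trans y2h hd).
have H2 := Hd' _ _ (le_lt_trans x1h hd') (le_lt_trans y1h hd').
have tE x : x + h - x = h by rewrite addrAC subrr add0r.
have {}E1 : f (t + h) (r + h) - f (t + h) r - (f t (r + h) - f t r) =
  (partial1 f x1 (r + h) - partial1 f x1 r) * h by exact: etrans E1 (congr1 _ (tE t)).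
have {}E3 : f (t + h) (r + h) - f t (r + h) - (f (t + h) r - f t r) =
  (partial2 f (t + h) y2 - partial2 f t y2) * h by exact: etrans E3 (congr1 _ (tE r)).
have {}E2 : partial1 f x1 (r + h) - partial1 f x1 r =
  partial2 (partial1 f) x1 y1 * h by exact: etrans E2 (congr1 _ (tE r)).
have {}E4 : partial2 f (t + h) y2 - partial2 f t y2 =
  partial1 (partial2 f) x2 y2 * h by exact: etrans E4 (congr1 _ (tE t)).
have EE : partial2 (partial1 f) x1 y1 = partial1 (partial2 f) x2 y2.
  have h0' : h != 0 by rewrite gt_eqF.
  apply: (mulIf h0'); apply: (mulIf h0').
  apply: etrans (esym (etrans E1 (congr1 (fun x => x * h) E2))) _.
  apply: etrans _ (etrans E3 (congr1 (fun x => x * h) E4)).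
  by move: (f _ _) (f _ r) (f t _) => *; ring.
rewrite EE in H2.
exact: dist_half H1 H2.
Qed.

Lemma integrable_smooth (g : R -> R) a b : smooth g ->
  mu.-integrable `[a, b] (EFin \o g).
Proof.
move=> sg; apply: continuous_compact_integrable; first exact: segment_compact.
by apply: continuous_subspaceT => t; exact: (@smooth_continuous _ _ sg t).
Qed.

Lemma Rintegral_cst_itv a b c : a <= b ->
  (\int[mu]_(r in `[a, b]) c)%R = c * (b - a).
Proof.
move=> ab; rewrite Rintegral_cst//; congr (_ * _).
apply: etrans (congr1 fine (@lebesgue_measure_itv R `[a, b])) _.
by rewrite /= lte_fin; case: ltgtP ab => // -> _; rewrite subrr.
Qed.

(** Second-order Taylor remainders are uniformly O(h^2) on the interval of
    integration. *)
Lemma is_derive_integral f a b t : a <= b -> smooth2 f ->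
  is_derive t 1 (fun s => \int[mu]_(r in `[a, b]) f s r)%R
    (\int[mu]_(r in `[a, b]) partial1 f t r)%R.
Proof.
move=> ab sf.
have [B HB] := @box_bounded R (fun t r => iter 2 tvs_derive (f^~ r) t)
  (t - 1) (t + 1) a b (fun t r => near2_iter_bounded 2 t r sf).
apply/tvs_is_deriveR/cvgrPdist_le => /= e e0.
pose K := `|B| * (b - a) + 1.
have K0 : 0 < K by rewrite ltr_wpDl// mulr_ge0// subr_ge0.
near=> h.
have h0 : h != 0 by near: h; exact: nbhs_dnbhs_neq.
have h1 : `|h| < 1 by near: h; exact: near_dnbhs0.
have he : `|h| < e / K by near: h; apply: near_dnbhs0; rewrite divr_gt0.
have I1 s := integrable_smooth a b (smooth2_2 s sf).
have I2 s := integrable_smooth a b (smooth2_2 s (smooth2_d1 sf)).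
have sT r : smooth (fun r => f (h + t) r - f t r - h * partial1 f t r).
  apply: smoothB; first by apply: smoothB; exact: smooth2_2.
  by apply: smoothM; [exact: smooth_cst|exact: (smooth2_2 t (smooth2_d1 sf))].
have E : (\int[mu]_(r in `[a, b]) partial1 f t r -
    h^-1 * (\int[mu]_(r in `[a, b]) f (h + t) r - \int[mu]_(r in `[a, b]) f t r) =
  - h^-1 * \int[mu]_(r in `[a, b]) (f (h + t) r - f t r - h * partial1 f t r))%R.
  rewrite RintegralB//; last 2 first.
  - by apply: integrable_smooth; apply: smoothB; exact: smooth2_2.
  - apply: integrable_smooth; apply: smoothM; first exact: smooth_cst.
    exact: (smooth2_2 t (smooth2_d1 sf)).
  rewrite RintegralB// RintegralZl//.
  by field.
rewrite scaleRE E normrM normrN normfV ler_pdivrMl ?normr_gt0//.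
apply: le_trans (le_normr_Rintegral _ (integrable_smooth a b (sT 0))) _ => //.
apply: (@le_trans _ _ (\int[mu]_(r in `[a, b]) (`|B| * `|h| ^+ 2))%R).
  apply: le_Rintegral => //.
  - apply: continuous_compact_integrable; first exact: segment_compact.
    apply: continuous_subspaceT => r; apply: (@cvg_norm _ R^o).
    exact: (@smooth_continuous _ _ (sT 0) r).
  - exact: integrable_smooth (smooth_cst _).
  - move=> r /=; rewrite in_itv/= => rab.
    have := @taylor1 R (f^~ r) `|B| t (h + t) (smooth2_1 r sf).
    rewrite addrK; apply=> s st.
    apply: le_trans (ler_norm _); apply: (HB s r) => //.
    by rewrite -ler_distl (le_trans st)// ltW.
rewrite Rintegral_cst_itv//.
rewrite mulrAC expr2 mulrA mulrC ler_pM2l ?normr_gt0//.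
apply: ltW; move: he; rewrite ltr_pdivlMr// /K mulrDr mulr1.
by apply: le_lt_trans; rewrite mulrC lerDl.
Unshelve. all: by end_near. Qed.

Lemma smooth_integral f a b : a <= b -> smooth2 f ->
  smooth (fun s => \int[mu]_(r in `[a, b]) f s r)%R.
Proof.
move=> ab sf; apply/smoothP => n; elim: n f sf => //= n IH f sf.
exists (fun t => \int[mu]_(r in `[a, b]) partial1 f t r)%R; split.
  by move=> t _; apply/tvs_is_deriveR; exact: is_derive_integral.
exact/IH/smooth2_d1.
Qed.

Lemma FTC_smooth (g : R -> R) a b : a < b -> smooth g ->
  (\int[mu]_(r in `[a, b]) tvs_derive g r)%R = g b - g a.
Proof.
move=> ab sg; have cg := @smooth_continuous _ _ sg.
rewrite /Rintegral (@continuous_FTC2 _ (tvs_derive g) g)//.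
- by apply: continuous_subspaceT => t; exact: (@smooth_continuous _ _ (smooth_derive sg) t).
- split.
  + by move=> t _; have [] := smoothR_is_derive t sg.
  + by apply: cvg_at_right_filter; exact: cg.
  + by apply: cvg_at_left_filter; exact: cg.
Qed.

(** Hadamard's lemma: the quotient is the integral of a'(t r) over 0 <= r <= 1. *)
Lemma smooth_quotient (a : R -> R) : smooth a ->
  smooth (fun t => if t == 0 then tvs_derive a 0 else t^-1 * (a t - a 0)).
Proof.
move=> sa.
pose f t r := tvs_derive a (t * r).
have sf : smooth2 f.
  move=> c d sc sd; apply: (smooth_comp (smooth_derive sa)).
  exact: smoothM.
have := smooth_integral ler01 sf; congr smooth; apply/funext => t.
case: eqVneq => [->|t0].
  rewrite /f; under eq_Rintegral do rewrite mul0r.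
  by rewrite Rintegral_cst_itv// subr0 mulr1.
have st : smooth (fun r => a (t * r)).
  apply: (smooth_comp sa); apply: smoothM; [exact: smooth_cst|exact: smooth_id].
have := FTC_smooth ltr01 st; rewrite mulr1 mulr0 => <-.
have dE r : tvs_derive (fun r => a (t * r)) r = t * f t r.
  apply: is_derive_tvs; rewrite mulrC.
  apply: (@is_derive1_comp _ a (fun r => t * r)); first exact: smoothR_is_derive.
  by apply: (is_derive_eq (is_deriveZ t (is_derive_id r 1))); rewrite scaleRE mulr1.
under [in RHS]eq_Rintegral do rewrite dE.
rewrite RintegralZl ?mulKf//.
by apply: integrable_smooth; exact: smooth2_2.
Qed.

End smooth2_scalar.

(** * Mean values and bounded sets in locally convex spaces *)

Section locally_convex.
Context {R : realType} {E : tvsType R}.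
Implicit Types (c d : R -> E) (t r : R).

Definition abs_convex (V : set E) : Prop :=
  (forall a x y, 0 <= a <= 1 -> V x -> V y -> V (a *: x + (1 - a) *: y)) /\
  (forall x, V x -> V (- x)).

Lemma abs_convex_balanced V a x : abs_convex V -> V 0 -> `|a| <= 1 -> V x ->
  V (a *: x).
Proof.
move=> [cV sV] V0; have H b : 0 <= b <= 1 -> V x -> V (b *: x).
  by move=> b01 Vx; have := cV b x 0 b01 Vx V0; rewrite scaler0 addr0.
have [a0|a0] := leP 0 a.
  by rewrite ger0_norm// => a1; apply: H; rewrite a0.
rewrite ltr0_norm// => a1 Vx.
rewrite -[a]opprK scaleNr; apply: sV; apply: H => //.
by rewrite a1 andbT oppr_ge0 ltW.
Qed.

Lemma nbhs0_abs_convex (U : set E) : nbhs 0 U ->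
  exists V : set E, [/\ open V, V 0, abs_convex V & V `<=` U].
Proof.
move=> U0; have [B Bc [Bo Bb]] := @locally_convex R E.
have [W [BW W0] WU] := Bb _ _ U0.
have Wo : open W by exact: Bo.
have Wc a x y : 0 <= a <= 1 -> W x -> W y -> W (a *: x + (1 - a) *: y).
  move=> a01 Wx Wy.
  have /Bc : W \in B by rewrite inE.
  move=> /(_ x y (Itv01 (proj1 (andP a01)) (proj2 (andP a01)))).
  by rewrite !inE; apply.
exists (W `&` -%R @^-1` W); split.
- apply: openI => //; apply: open_comp => // x _; exact: (@opp_continuous E).
- by split => //=; rewrite oppr0.
- split => [a x y a01 [Wx Wx'] [Wy Wy']|x [Wx Wx']]; split => //=.
  + exact: Wc.
  + by rewrite opprD -!scalerN; exact: Wc.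
  + by rewrite opprK.
- by move=> x [/WU].
Qed.

(** The mean slope lies in every open absolutely convex set that contains all the
    derivatives.  Slopes over adjacent intervals combine convexly, and slopes over
    short intervals at t lie in V because c' t does; so the supremum of the
    endpoints that can be reached from a is attained and equals b. *)
Lemma mean_value_convex c (c' : R -> E) (V : set E) (a b : R) : a < b ->
  open V -> abs_convex V ->
  (forall t, a <= t <= b -> tvs_is_derive c t (c' t)) ->
  (forall t, a <= t <= b -> V (c' t)) ->
  V ((b - a)^-1 *: (c b - c a)).
Proof.
move=> ab oV [cV _] cc' c'V.
pose q x y := (y - x)^-1 *: (c y - c x).
have qC x y : q x y = q y x.
  by rewrite /q -opprB invrN scaleNr -scalerN opprB.
have local t : a <= t <= b -> exists2 d : R, 0 < d & forall y, `|y - t| < d ->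
    y != t -> V (q t y).
  move=> tab; have nV : nbhs (c' t) V by apply: open_nbhs_nbhs; split => //; exact: c'V.
  have /= /nbhs_ballP [d d0 Hd] := cc' _ tab V nV.
  exists d => // y yt yt0; have := Hd (y - t).
  rewrite -ball_normE /= sub0r normrN subrK => /(_ yt); apply.
  by rewrite subr_eq0.
have add x t y : x < t -> t < y -> V (q x t) -> V (q t y) -> V (q x y).
  move=> xt ty Vx Vy.
  have yx : 0 < y - x by lra.
  have := cV ((t - x) / (y - x)) (q x t) (q t y).
  have -> : (t - x) / (y - x) *: q x t + (1 - (t - x) / (y - x)) *: q t y = q x y.
    have -> : 1 - (t - x) / (y - x) = (y - t) / (y - x) by field; rewrite gt_eqF.
    rewrite /q !scalerA !(mulrAC _ (y - x)^-1) !mulfV ?mul1r; try by rewrite gt_eqF// subr_gt0.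
    by rewrite -scalerDr; congr (_ *: _); rewrite addrC addrA subrK.
  apply=> //; apply/andP; split; first by rewrite divr_ge0; lra.
  by rewrite ler_pdivrMr//; lra.
pose S := [set y | a <= y <= b /\ (y = a \/ V (q a y))].
have Sa : S a by split; [rewrite lexx ltW|left].
have hS : has_sup S.
  by split; [exists a|exists b => y [/andP[]]].
have ub y : S y -> y <= sup S by move=> Sy; apply: ub_le_sup => //; case: hS.
have sab : a <= sup S <= b.
  by rewrite ub//= ge_sup//; [exists a|move=> y [/andP[]]].
have [d d0 Hd] := local _ sab.
have Ss : S (sup S).
  split => //; have [y Sy ys] := sup_adherent d0 hS.
  have := ub _ Sy; rewrite le_eqVlt => /predU1P[<-|ys']; first by case: Sy.
  have Vys : V (q y (sup S)).
    rewrite qC; apply: Hd; last by rewrite lt_eqF.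
    by rewrite ltr_distlC; apply/andP; split; lra.
  have [yab [<-|Vy]] := Sy; first by right.
  have [ya|ya] := eqVneq y a; first by rewrite -ya; right.
  right; apply: add Vy Vys => //; rewrite lt_neqAle eq_sym ya/=.
  by case/andP: yab.
have [sb|sb] := eqVneq (sup S) b.
  by case: Ss => _ []; rewrite sb // => ba; move: ab; rewrite ba ltxx.
have sb' : sup S < b by rewrite lt_neqAle sb; case/andP: sab.
pose y := Num.min (sup S + d / 2) b.
have ys : sup S < y by rewrite lt_min sb' andbT ltrDl divr_gt0.
have yd : y <= sup S + d / 2 by rewrite ge_min lexx.
have yb : y <= b by rewrite ge_min lexx orbT.
have Vsy : V (q (sup S) y).
  apply: Hd; last by rewrite gt_eqF.
  by rewrite gtr0_norm; lra.
have /ub : S y.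
  split; first by rewrite yb andbT (le_trans _ (ltW ys))//; case/andP: sab.
  right; have [_ [sa|Vs]] := Ss; first by rewrite -sa.
  have [sa|sa] := eqVneq (sup S) a; first by rewrite -sa.
  apply: add Vs Vsy => //; rewrite lt_neqAle eq_sym sa/=.
  by case/andP: sab.
by rewrite leNgt ys.
Qed.

(** ** Bounded sets *)

Lemma vN_boundedP (B : set E) :
  (forall V : set E, open V -> V 0 -> abs_convex V ->
     exists2 r : R, 0 < r & forall x, B x -> V (r^-1 *: x)) ->
  vN_bounded B.
Proof.
move=> H U /nbhs0_abs_convex [V [oV V0 cV VU]].
have [r r0 BV] := H V oV V0 cV; exists r => // k rk x Bx.
have k0 : k != 0 by rewrite -normr_gt0 (lt_le_trans r0).
exists (k^-1 *: x) => /=; last by rewrite scalerA mulfV// scale1r.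
apply: VU; have -> : k^-1 *: x = (r / k) *: (r^-1 *: x).
  by rewrite scalerA mulrAC mulfV ?mul1r// gt_eqF.
apply: abs_convex_balanced => //; last exact: BV.
rewrite normf_div (gtr0_norm r0) ler_pdivrMr ?mul1r//.
by rewrite normr_gt0.
Qed.

Lemma vN_boundedE (B : set E) (V : set E) : vN_bounded B -> nbhs 0 V ->
  exists2 r : R, 0 < r & forall k, r <= k -> forall x, B x -> V (k^-1 *: x).
Proof.
move=> bB V0; have [r r0 H] := bB V V0; exists r => // k rk x Bx.
have k0 : 0 < k by exact: lt_le_trans rk.
have [|y Vy <-] := H k _ x Bx; first by rewrite gtr0_norm.
by rewrite scalerA mulVf ?gt_eqF// scale1r.
Qed.

Lemma vN_boundedU (A B : set E) : vN_bounded A -> vN_bounded B ->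
  vN_bounded (A `|` B).
Proof.
move=> bA bB; apply: vN_boundedP => V oV V0 cV.
have nV : nbhs 0 V by exact: open_nbhs_nbhs.
have [r r0 HA] := vN_boundedE bA nV; have [s s0 HB] := vN_boundedE bB nV.
exists (r + s); first by rewrite addr_gt0.
by move=> x []; [apply: HA|apply: HB]; rewrite ?lerDl ?lerDr ltW.
Qed.

Lemma tvs_cvgD {T : Type} (F : set_system T) {FF : Filter F} (f g : T -> E)
    (x y : E) : f s @[s --> F] --> x -> g s @[s --> F] --> y ->
  (f s + g s) @[s --> F] --> x + y.
Proof. by move=> fx gy; apply: (cvg_comp2 fx gy (@add_continuous E (x, y))). Qed.

Lemma tvs_cvgZ {T : Type} (F : set_system T) {FF : Filter F} (k : T -> R)
    (f : T -> E) (a : R) (x : E) : k s @[s --> F] --> a ->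
  f s @[s --> F] --> x -> (k s *: f s) @[s --> F] --> a *: x.
Proof.
by move=> ka fx; apply: (cvg_comp2 ka fx (@scale_continuous R E (a, x))).
Qed.

Lemma tvs_is_derive_continuous c t (v : E) : tvs_is_derive c t v ->
  c s @[s --> t] --> c t.
Proof.
move=> cv U nU.
have H : (h *: (h^-1 *: (c (h + t) - c t)) + c t) @[h --> 0^'] --> 0 *: v + c t.
  have h0 : (h : R) @[h --> 0^'] --> (0 : R) by exact: nbhs_dnbhs.
  by apply: tvs_cvgD; [exact: tvs_cvgZ|exact: cvg_cst].
have {}H : \forall h \near (0 : R)^', U (c (h + t)).
  have := H U; rewrite scale0r add0r => /(_ nU) /= {}H.
  near=> h; have h0 : h != 0 by near: h; exact: nbhs_dnbhs_neq.
  have : U (h *: (h^-1 *: (c (h + t) - c t)) + c t) by near: h.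
  by rewrite scalerA mulfV// scale1r subrK.
move: H; rewrite /dnbhs /within /= => /nbhs_ballP [d d0 Hd].
suff : \forall s \near t, U (c s) by [].
near=> s; have [->|st] := eqVneq s t; first exact: nbhs_singleton.
have := Hd (s - t); rewrite -ball_normE /= sub0r normrN subrK; apply.
  by near: s; exact: near_dist.
by rewrite subr_eq0.
Unshelve. all: by end_near. Qed.

(** Compactness of the segment: locally, c t / k is in V for all large k. *)
Lemma vN_bounded_segment c (a b : R) :
  (forall t, a <= t <= b -> c s @[s --> t] --> c t) ->
  vN_bounded [set c t | t in `[a, b]].
Proof.
move=> cc; apply: vN_boundedP => V oV V0 _.
have nV : nbhs 0 V by exact: open_nbhs_nbhs.
have := (compact_near_coveringP _).1 (@segment_compact R a b) _ +oo%R
  (fun k t => V (k^-1 *: c t)) _.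
case=> [t tab|B [_ HB]].
  have [[A W] [/= nA nW] AW] : nbhs ((0 : R^o), c t) [set z | V (z.1 *: z.2)].
    by apply: (@scale_continuous R E (0, c t)); rewrite /= scale0r.
  move: nA => /nbhs_ballP [e e0 Ae].
  exists (c @^-1` W, [set k | e^-1 < k]) => /=.
    split; first exact: (cc t tab).
    by exists e^-1; split => //; exact: num_real.
  move=> [s k] /= [Ws ek]; apply: (AW (k^-1, c s)); split => //=.
  apply: Ae; rewrite -ball_normE /= sub0r normrN.
  have ei : 0 < e^-1 by rewrite invr_gt0.
  by rewrite gtr0_norm ?invr_gt0 ?(lt_trans ei)// -[e]invrK ltf_pV2 ?posrE// (lt_trans ei).
exists (Num.max B 0 + 1); first by rewrite ltr_wpDl// le_max lexx orbT.
move=> x [t tab <-]; apply: (HB (Num.max B 0 + 1) _ t) => //.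
by rewrite ltr_pwDr// le_max lexx.
Qed.

Lemma smooth_continuousE c t : smooth c -> c s @[s --> t] --> c t.
Proof.
by move=> sc; apply: (@tvs_is_derive_continuous _ _ (tvs_derive c t));
  exact: smooth_is_derive.
Qed.

Lemma tvs_is_deriveZ c t (v : E) (k : R) : tvs_is_derive c t v ->
  tvs_is_derive (fun s => k *: c s) t (k *: v).
Proof.
move=> cv; have H := tvs_cvgZ (cvg_cst k) cv.
rewrite /tvs_is_derive; under eq_fun do rewrite -scalerBr scalerA mulrC -scalerA.
exact: H.
Qed.

Lemma tvs_is_deriveD c d t (v w : E) : tvs_is_derive c t v ->
  tvs_is_derive d t w -> tvs_is_derive (fun s => c s + d s) t (v + w).
Proof.
move=> cv dw; have H := tvs_cvgD cv dw.
rewrite /tvs_is_derive; under eq_fun do rewrite opprD addrACA scalerDr.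
exact: H.
Qed.

Lemma tvs_is_derive_line t (x v : E) : tvs_is_derive (fun s => x + s *: v) t v.
Proof.
move=> U nU; suff : \forall h \near (0 : R)^',
  U (h^-1 *: (x + (h + t) *: v - (x + t *: v))) by [].
near=> h; have h0 : h != 0 by near: h; exact: nbhs_dnbhs_neq.
rewrite opprD addrACA subrr add0r -scalerBl addrK scalerA mulVf// scale1r.
exact: nbhs_singleton.
Unshelve. all: by end_near. Qed.

Definition remainder c t (h : R) : E :=
  (h ^- 2) *: (c (h + t) - c t - h *: tvs_derive c t).

Lemma mean_slope_convex c (c' : R -> E) (V : set E) (x y : R) : x != y ->
  open V -> abs_convex V ->
  (forall t, `|t - x| <= `|y - x| -> tvs_is_derive c t (c' t)) ->
  (forall t, `|t - x| <= `|y - x| -> V (c' t)) ->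
  V ((y - x)^-1 *: (c y - c x)).
Proof.
move=> xy oV cV cc' c'V; have [xy'|yx|e] := ltgtP x y; last by rewrite e eqxx in xy.
  have H t : x <= t <= y -> `|t - x| <= `|y - x|.
    by move=> /andP[xt ty]; rewrite !ger0_norm ?subr_ge0 ?lerB// ltW.
  by apply: mean_value_convex xy' oV cV _ _ => t /H; [exact: cc'|exact: c'V].
have H t : y <= t <= x -> `|t - x| <= `|y - x|.
  move=> /andP[yt tx]; rewrite !(distrC _ x) !ger0_norm ?subr_ge0 ?lerB//.
  exact: ltW.
have -> : (y - x)^-1 *: (c y - c x) = (x - y)^-1 *: (c x - c y).
  by rewrite -[y - x]opprB invrN scaleNr -scalerN opprB.
by apply: mean_value_convex yx oV cV _ _ => t /H; [exact: cc'|exact: c'V].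
Qed.

(** The second derivative is bounded near t.  The mean value theorem, applied first
    to the derivative and then to the first-order remainder, transfers this bound
    to the second-order remainder. *)
Lemma vN_bounded_remainder c t : smooth c ->
  vN_bounded [set remainder c t h | h in [set h | 0 < `|h| <= 1]].
Proof.
move=> sc; have sc' := smooth_derive sc; have sc'' := smooth_derive sc'.
apply: vN_boundedP => V oV V0 cV.
have nV : nbhs 0 V by exact: open_nbhs_nbhs.
have [r r0 Hr] := vN_boundedE (vN_bounded_segment
  (fun s (_ : t - 1 <= s <= t + 1) => @smooth_continuousE _ s sc'')) nV.
have {}Hr s : `|s - t| <= 1 -> V (r^-1 *: tvs_derive (tvs_derive c) s).
  move=> st; apply: Hr => //; exists s => //=.
  by rewrite in_itv/= -ler_distl.
exists r => // _ [h /= /andP[h0 h1] <-].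
have hn0 : h != 0 by rewrite -normr_gt0.
have slope s : s != 0 -> `|s| <= 1 ->
    V (s^-1 *: (r^-1 *: tvs_derive c (s + t) - r^-1 *: tvs_derive c t)).
  move=> s0 s1; have := @mean_slope_convex (fun s => r^-1 *: tvs_derive c s)
    (fun s => r^-1 *: tvs_derive (tvs_derive c) s) V t (s + t).
  rewrite addrK; apply => //.
  - by rewrite eq_sym -subr_eq0 addrK.
  - by move=> u _; apply: tvs_is_deriveZ; exact: smooth_is_derive.
  - by move=> u ut; apply: Hr; exact: le_trans s1.
pose e s := h^-1 *: (r^-1 *: c (s + t) + s *: (- (r^-1 *: tvs_derive c t))).
pose e' s := h^-1 *: (r^-1 *: tvs_derive c (s + t) - r^-1 *: tvs_derive c t).
have := @mean_slope_convex e e' V 0 h.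
rewrite subr0 => /(_ _ oV cV).
have -> : h^-1 *: (e h - e 0) = r^-1 *: remainder c t h.
  rewrite /e /remainder add0r scale0r addr0 -scalerBr addrAC scalerN.
  rewrite -scalerBr (scalerA h) (mulrC h) -(scalerA r^-1) -scalerBr !scalerA.
  by congr (_ *: _); field; rewrite hn0 gt_eqF.
apply.
- by rewrite eq_sym.
- move=> s _; apply: tvs_is_deriveZ; apply: tvs_is_deriveD.
    by apply: tvs_is_deriveZ; apply/tvs_is_derive_shift; exact: smooth_is_derive.
  have := @tvs_is_derive_line s 0 (- (r^-1 *: tvs_derive c t)).
  by under eq_fun do rewrite add0r.
- move=> s; rewrite subr0 => sh; rewrite /e'.
  have [->|s0] := eqVneq s 0; first by rewrite add0r subrr scaler0.
  have -> : h^-1 = s / h * s^-1 by rewrite mulrAC mulfV ?mul1r.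
  rewrite -scalerA; apply: abs_convex_balanced => //.
    by rewrite normf_div ler_pdivrMr// mul1r.
  by apply: slope => //; exact: le_trans h1.
Qed.

End locally_convex.

(** * Bounded functionals and weak inner products *)

Section functionals.
Context {R : realType} {E : tvsType R}.
Implicit Types (c d : R -> E) (t r : R) (l : E -> R).

Lemma scalar0 l : scalar l -> l 0 = 0.
Proof.
by move=> Ll; have := Ll (-1) 0 0; rewrite scaleN1r oppr0 addr0 mulN1r addNr.
Qed.

Lemma scalarD l x y : scalar l -> l (x + y) = l x + l y.
Proof. by move=> Ll; have := Ll 1 x y; rewrite scale1r mul1r. Qed.

Lemma scalarZ l a x : scalar l -> l (a *: x) = a * l x.
Proof. by move=> Ll; have := Ll a x 0; rewrite !addr0 (scalar0 Ll) addr0. Qed.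

Lemma scalarN l x : scalar l -> l (- x) = - l x.
Proof. by move=> Ll; rewrite -scaleN1r scalarZ// mulN1r. Qed.

Lemma scalarB l x y : scalar l -> l (x - y) = l x - l y.
Proof. by move=> Ll; rewrite scalarD// scalarN. Qed.

(** The class contains the continuous linear functionals and also the functionals
    < ,w>, which are only bounded. *)
Definition smooth_functional l : Prop := scalar l /\
  forall c t, smooth c -> is_derive t 1 (l \o c) (l (tvs_derive c t)).

Lemma smooth_functional_comp l c : smooth_functional l -> smooth c ->
  smooth (fun t => l (c t)).
Proof.
move=> [_ Hl] sc; apply/smoothP => n; elim: n c sc => //= n IH c sc.
exists (fun t => l (tvs_derive c t)); split; last exact/IH/smooth_derive.
by move=> t _; apply/tvs_is_deriveR; exact: Hl.
Qed.

Lemma smooth_functional_derive l c t : smooth_functional l -> smooth c ->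
  tvs_derive (fun s => l (c s)) t = l (tvs_derive c t).
Proof. by move=> [_ Hl] sc; apply: is_derive_tvs; exact: Hl. Qed.

Lemma smooth2_functional l (F : R -> R -> E) : smooth_functional l ->
  smooth2 F -> smooth2 (fun t r => l (F t r)).
Proof.
move=> Hl sF c d sc sd; apply: (@smooth_functional_comp l (fun t => F (c t) (d t))) => //.
exact: sF.
Qed.

Lemma functional_is_derive l c t v : scalar l -> continuous l ->
  tvs_is_derive c t v -> tvs_is_derive (fun s => l (c s)) t (l v).
Proof.
move=> Ll cl cv; rewrite /tvs_is_derive.
have -> : (fun h => h^-1 *: (l (c (h + t)) - l (c t))) =
    (fun h => l (h^-1 *: (c (h + t) - c t))).
  by apply/funext => h; rewrite scalarZ// scalarB.
exact: (cvg_comp _ _ cv (cl v)).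
Qed.

Lemma continuous_smooth_functional l : scalar l -> continuous l ->
  smooth_functional l.
Proof.
move=> Ll cl; split => // c t sc; apply/tvs_is_deriveR.
by apply: functional_is_derive => //; exact: smooth_is_derive.
Qed.

Lemma Ck_functional l n J c : scalar l -> continuous l ->
  Ck n J c -> Ck n J (fun t => l (c t)).
Proof.
move=> Ll cl; elim: n c => //= n IH c [c' [cc' Cc']].
exists (fun t => l (c' t)); split; last exact: IH.
by move=> t Jt; apply: functional_is_derive => //; exact: cc'.
Qed.

End functionals.

Section constants.
Context {R : realType} {E : tvsType R}.
Implicit Types (x : E) (t : R).

Lemma tvs_is_derive_cst t x : tvs_is_derive (fun=> x) t 0.
Proof.
rewrite /tvs_is_derive; under eq_fun do rewrite subrr scaler0.
exact: cvg_cst.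
Qed.

Lemma tvs_derive_cst t x : hausdorff_space E -> tvs_derive (fun=> x) t = 0.
Proof. by move=> hE; apply: tvs_is_derive_val => //; exact: tvs_is_derive_cst. Qed.

Lemma smooth_cstE x : hausdorff_space E -> smooth (fun=> x : E).
Proof.
move=> hE; apply/(smooth_onP _ hE openT) => n; elim: n x => //= n IH x.
by exists (fun=> 0); split => // t _; exact: tvs_is_derive_cst.
Qed.

End constants.

Section weak_inner_product.
Context {R : realType} {E : tvsType R} (ip : E -> E -> R).
Hypothesis hip : weak_inner_product ip.
Implicit Types (c d : R -> E) (t r : R).

Let ipl y : scalar (ip^~ y) := ip_linear hip y.
Let ipC x y : ip x y = ip y x := ip_sym hip x y.

Lemma ipDl x y z : ip (x + y) z = ip x z + ip y z.
Proof. exact: (@scalarD _ _ (ip^~ z) x y (ipl z)). Qed.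

Lemma ipZl a x z : ip (a *: x) z = a * ip x z.
Proof. exact: (@scalarZ _ _ (ip^~ z) a x (ipl z)). Qed.

Lemma ipNl x z : ip (- x) z = - ip x z.
Proof. exact: (@scalarN _ _ (ip^~ z) x (ipl z)). Qed.

Lemma ip0l z : ip 0 z = 0.
Proof. exact: (@scalar0 _ _ (ip^~ z) (ipl z)). Qed.

Lemma ipDr x y z : ip z (x + y) = ip z x + ip z y.
Proof. by rewrite ipC ipDl !(ipC _ z). Qed.

Lemma ipZr a x z : ip z (a *: x) = a * ip z x.
Proof. by rewrite ipC ipZl ipC. Qed.

Lemma ip_eq0 x : ip x x = 0 -> x = 0.
Proof.
by move=> x0; apply/eqP; apply: contraTT isT => /(ip_pos hip); rewrite x0 ltxx.
Qed.

Lemma ip_ext x y : (forall z, ip x z = ip y z) -> x = y.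
Proof.
move=> xy; apply/eqP; rewrite -subr_eq0; apply/eqP/ip_eq0.
by rewrite ipDl ipNl xy subrr.
Qed.

(** Substitute the second-order Taylor expansions of c and d at t.  The terms of order
    at least 2 in h pair elements of a bounded set, so they are O(h^2). *)
Lemma is_derive_ip c d t : smooth c -> smooth d ->
  is_derive t 1 (fun s => ip (c s) (d s))
    (ip (tvs_derive c t) (d t) + ip (c t) (tvs_derive d t)).
Proof.
move=> sc sd; set c' := tvs_derive c t; set d' := tvs_derive d t.
pose rem (e : R -> E) := [set remainder e t h | h in [set h : R | 0 < `|h| <= 1]].
pose pt (x : E) := [set (fun=> x) s | s in `[(0 : R)%R, 1%R]].
have bpt x : vN_bounded (pt x).
  by apply: vN_bounded_segment => s _; exact: cvg_cst.
have ptx x : pt x x by exists 0 => //=; rewrite in_itv/= lexx ler01.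
pose B := (pt (c t) `|` pt c' `|` rem c) `|` (pt (d t) `|` pt d' `|` rem d).
have bB : vN_bounded B.
  by do ![apply: vN_boundedU => //]; exact: vN_bounded_remainder.
have [C HC] := ip_bounded hip bB.
apply/tvs_is_deriveR/cvgrPdist_le => /= e e0.
pose K := 6 * `|C| + 1; have K0 : 0 < K by rewrite ltr_wpDl// mulr_ge0.
near=> h.
have h0 : h != 0 by near: h; exact: nbhs_dnbhs_neq.
have h1 : `|h| < 1 by near: h; exact: near_dnbhs0.
have he : `|h| < e / K by near: h; apply: near_dnbhs0; rewrite divr_gt0.
have taylor (f : R -> E) : exists2 x, rem f x & f (h + t) =
    f t + h *: tvs_derive f t + h ^+ 2 *: x.
  exists (remainder f t h); first by exists h => //=; rewrite normr_gt0 h0 ltW.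
  rewrite /remainder scalerA mulfV ?expf_neq0// scale1r.
  by rewrite -(addrA (f (h + t))) -opprD [RHS]addrC subrK.
have [x remx Ec] := taylor c; have [y remy Ed] := taylor d.
rewrite scaleRE Ec Ed -/c' -/d'.
have Bc : B (c t) by do 2 left; left.
have Bc' : B c' by left; left; right.
have Bx : B x by left; right.
have Bd : B (d t) by right; left; left.
have Bd' : B d' by right; left; right.
have By : B y by right; right.
rewrite !(ipDl, ipDr, ipZl, ipZr).
rewrite [X in `|X|](_ : _ = - h * (ip c' d' + ip (c t) y + ip x (d t) +
  h * ip c' y + h * ip x d' + h ^+ 2 * ip x y)); last by field.
rewrite normrM normrN.
have n1 a : `|h * a| <= `|a| by rewrite normrM ler_piMl// ltW.
have n2 a : `|h ^+ 2 * a| <= `|a| by rewrite expr2 -mulrA; apply: le_trans (n1 _) (n1 _).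
have HB u v : B u -> B v -> `|ip u v| <= `|C|.
  by move=> Bu Bv; apply: le_trans (HC _ _ Bu Bv) (ler_norm _).
have nD (u v m n : R) : `|u| <= m -> `|v| <= n -> `|u + v| <= m + n.
  by move=> um vn; apply: le_trans (ler_normD _ _) (lerD um vn).
apply: (@le_trans _ _ (`|h| * (6 * `|C|))).
  apply: ler_wpM2l => //.
  rewrite (_ : 6 * `|C| = `|C| + `|C| + `|C| + `|C| + `|C| + `|C|); last by ring.
  apply: nD (nD _ _ _ _ (nD _ _ _ _ (nD _ _ _ _ (nD _ _ _ _
    (HB _ _ Bc' Bd') (HB _ _ Bc By)) (HB _ _ Bx Bd)) _) _) _.
  - exact: le_trans (n1 _) (HB _ _ Bc' By).
  - exact: le_trans (n1 _) (HB _ _ Bx Bd').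
  - exact: le_trans (n2 _) (HB _ _ Bx By).
apply: ltW; move: he; rewrite ltr_pdivlMr// /K mulrDr mulr1.
by apply: le_lt_trans; rewrite lerDl.
Unshelve. all: by end_near. Qed.

Lemma smooth_ip c d : smooth c -> smooth d -> smooth (fun t => ip (c t) (d t)).
Proof.
move=> sc sd; apply/smoothP => n; elim: n c d sc sd => //= n IH c d sc sd.
exists (fun t => ip (tvs_derive c t) (d t) + ip (c t) (tvs_derive d t)); split.
  by move=> t _; apply/tvs_is_deriveR; exact: is_derive_ip.
by apply: CkD; apply: IH => //; exact: smooth_derive.
Qed.

Lemma smooth2_ip (F G : R -> R -> E) : smooth2 F -> smooth2 G ->
  smooth2 (fun t r => ip (F t r) (G t r)).
Proof. by move=> sF sG c d sc sd; apply: smooth_ip; [exact: sF|exact: sG]. Qed.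

Lemma smooth_functional_ip w : hausdorff_space E -> smooth_functional (ip^~ w).
Proof.
move=> hE; split => // c t sc.
apply: (is_derive_eq (is_derive_ip t sc (smooth_cstE w hE))).
by rewrite tvs_derive_cst// (ipC (c t)) ip0l addr0.
Qed.

End weak_inner_product.

(** * Surfaces in convenient vector spaces *)

Section convenient.
Context {R : realType} {E : tvsType R} (convE : convenient E).
Implicit Types (c d : R -> E) (t r : R).

Let hE : hausdorff_space E := proj1 convE.

Lemma smooth_from_functionals c :
  (forall l : E -> R, scalar l -> continuous l -> smooth (fun t => l (c t))) ->
  smooth c.
Proof. exact: (proj2 convE). Qed.

Lemma smooth_functionalE (l : E -> R) c : scalar l -> continuous l ->
  smooth c -> smooth (fun t => l (c t)).
Proof.
by move=> Ll cl; apply: smooth_functional_comp; exact: continuous_smooth_functional.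
Qed.

Lemma smooth_compE c (f : R -> R) : smooth c -> smooth f ->
  smooth (fun t => c (f t)).
Proof.
move=> sc sf; apply: smooth_from_functionals => l Ll cl.
exact: (smooth_comp (smooth_functionalE Ll cl sc)).
Qed.

Lemma smooth_addE c d : smooth c -> smooth d -> smooth (fun t => c t + d t).
Proof.
move=> sc sd; apply: smooth_from_functionals => l Ll cl.
by under eq_fun do rewrite scalarD//; apply: smoothD; exact: smooth_functionalE.
Qed.

Lemma smooth_scaleE (f : R -> R) c : smooth f -> smooth c ->
  smooth (fun t => f t *: c t).
Proof.
move=> sf sc; apply: smooth_from_functionals => l Ll cl.
under eq_fun do rewrite scalarZ//.
by apply: smoothM => //; exact: smooth_functionalE.
Qed.

Lemma smooth_lineE (f : R -> R) (x v : E) : smooth f ->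
  smooth (fun t => x + f t *: v).
Proof.
move=> sf; apply: smooth_addE; first exact: smooth_cstE.
by apply: smooth_scaleE => //; exact: smooth_cstE.
Qed.

Lemma smooth_on_compE J c (f : R -> R) : open J -> smooth_on J c -> smooth f ->
  (forall t, J (f t)) -> smooth (fun t => c (f t)).
Proof.
move=> oJ /(smooth_onP _ hE oJ) Cc /smoothP Cf Jf.
apply: smooth_from_functionals => l Ll cl; apply/smoothP => n.
apply: (@Ck_comp _ n setT J (fun s => l (c s)) f) => //.
exact: Ck_functional.
Qed.

(** Convenience reduces the claim to the scalar functions l o F. *)
Lemma smooth_partialE (F : R -> R -> E) : smooth2 F ->
  smooth (fun t => tvs_derive (F t) 0).
Proof.
move=> sF; apply: smooth_from_functionals => l Ll cl.
have Hl := continuous_smooth_functional Ll cl.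
have := smooth_partial (smooth2_functional Hl sF).
congr smooth; apply/funext => t; apply: smooth_functional_derive => //.
exact: smooth2_2.
Qed.

Lemma smooth2_partial2 (F : R -> R -> E) : smooth2 F -> smooth2 (partial2 F).
Proof. by apply: smooth2_d2_of => G; exact: smooth_partialE. Qed.

Lemma smooth2_partial1 (F : R -> R -> E) : smooth2 F -> smooth2 (partial1 F).
Proof. by move=> /smooth2_swap/smooth2_partial2/smooth2_swap. Qed.

Lemma smooth_quotientE c : smooth c ->
  smooth (fun t => if t == 0 then tvs_derive c 0 else t^-1 *: (c t - c 0)).
Proof.
move=> sc; apply: smooth_from_functionals => l Ll cl.
have := smooth_quotient (smooth_functionalE Ll cl sc).
congr smooth; apply/funext => t; case: ifP => _.
  by rewrite smooth_functional_derive//; exact: continuous_smooth_functional.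
by rewrite (@scalarZ _ _ l)// (@scalarB _ _ l).
Qed.

(** ** Identities tested against a weak inner product *)

Section tested.
Variables (ip : E -> E -> R) (hip : weak_inner_product ip).

Let ipF w : smooth_functional (ip^~ w) := smooth_functional_ip hip w hE.

Lemma tvs_derive_diag (F : R -> R -> E) t : smooth2 F ->
  tvs_derive (fun s => F s s) t = partial1 F t t + partial2 F t t.
Proof.
move=> sF; apply: (ip_ext hip) => w; rewrite (ipDl hip).
have sD : smooth (fun s => F s s) by apply: sF; exact: smooth_id.
rewrite -(smooth_functional_derive t (ipF w) sD).
have := is_derive_diag t (smooth2_functional (ipF w) sF).
move=> /is_derive_tvs ->; congr (_ + _).
  by apply: (smooth_functional_derive t (ipF w)); exact: smooth2_1.
by apply: (smooth_functional_derive t (ipF w)); exact: smooth2_2.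
Qed.

Lemma partial12 (F : R -> R -> E) t r : smooth2 F ->
  partial1 (partial2 F) t r = partial2 (partial1 F) t r.
Proof.
move=> sF; apply: (ip_ext hip) => w; pose f t r := ip (F t r) w.
have f1 : partial1 f = fun t r => ip (partial1 F t r) w.
  apply/funext => s; apply/funext => q.
  exact: (smooth_functional_derive s (ipF w) (smooth2_1 q sF)).
have f2 : partial2 f = fun t r => ip (partial2 F t r) w.
  apply/funext => s; apply/funext => q.
  exact: (smooth_functional_derive q (ipF w) (smooth2_2 s sF)).
have := d1_d2 t r (smooth2_functional (ipF w) sF); rewrite -/f f1 f2.
rewrite (_ : partial1 _ t r = ip (partial1 (partial2 F) t r) w); last first.
  exact: (smooth_functional_derive t (ipF w) (smooth2_1 r (smooth2_partial2 sF))).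
move=> ->.
exact: (smooth_functional_derive r (ipF w) (smooth2_2 t (smooth2_partial1 sF))).
Qed.

(** Smoothness near x, stated for germs of surfaces through x: the composite need
    agree with a surface that is smooth along curves only near (0, 0). *)
Definition smooth_at (f : E -> E) (x : E) : Prop :=
  forall Phi : R -> R -> E, smooth2 Phi -> Phi 0 0 = x ->
    exists2 F : R -> R -> E, smooth2 F & near2 0 0 (fun t r => f (Phi t r) = F t r).

(** By Hadamard's lemma c t = c 0 + t v(t) with v smooth and v 0 = c' 0.  On the
    surface (t, r) |-> c 0 + t v(r) the curve c is the diagonal, the axis r = 0 is the
    tangent line of c, and the axis t = 0 is constant. *)
Lemma tvs_derive_comp (f : E -> E) c : smooth_at f (c 0) -> smooth c ->
  tvs_derive (fun s => f (c s)) 0 = dir_derive f (c 0) (tvs_derive c 0).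
Proof.
move=> fx sc; pose v t := if t == 0 then tvs_derive c 0 else t^-1 *: (c t - c 0).
have sv : smooth v by exact: smooth_quotientE.
have v0 : v 0 = tvs_derive c 0 by rewrite /v eqxx.
have cv t : c t = c 0 + t *: v t.
  rewrite /v; case: eqVneq => [->|t0]; first by rewrite scale0r addr0.
  by rewrite scalerA mulfV// scale1r addrC subrK.
pose Phi t r := c 0 + t *: v r.
have sPhi : smooth2 Phi.
  move=> a b sa sb; apply: smooth_addE; first exact: smooth_cstE.
  by apply: smooth_scaleE => //; exact: smooth_compE.
have [|F sF fF] := fx Phi sPhi; first by rewrite /Phi scale0r addr0.
have -> : tvs_derive (fun s => f (c s)) 0 = tvs_derive (fun s => F s s) 0.
  apply: tvs_derive_near; apply: filterS (near2_diag fF) => s <-.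
  by rewrite cv.
rewrite tvs_derive_diag// [X in _ + X](_ : _ = 0) ?addr0; last first.
  rewrite /partial2 (@tvs_derive_near _ _ _ (fun=> f (c 0))).
    exact: tvs_derive_cst.
  by apply: filterS (near2_2 fF) => s <-; rewrite /Phi scale0r addr0.
by apply: tvs_derive_near; apply: filterS (near2_1 fF) => s <-; rewrite /Phi v0.
Qed.

End tested.
End convenient.

(** * Curves and surfaces in a Lie group *)

Section localization.
Context {R : realType}.
Implicit Types (t r d : R).

Lemma smooth_on_comp_local (E : tvsType R) (J : set R) (c : R -> E) (f : R -> R) :
  convenient E -> open J -> smooth_on J c -> smooth f ->
  smooth_on (f @^-1` J) (fun t => c (f t)).
Proof.
move=> cE oJ sc sf; apply: smooth_on_local => t0 /= Jf.
have [d d0 Hd] := open_ball1 oJ Jf.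
have [e e0 He] := smooth_continuousD t0 sf d0.
have [g [sg g0 ge gn]] := exists_clamp t0 e0.
exists (fun t => c (f (g t))); split; last by apply: filterS gn => t ->.
apply: (@smooth_on_compE _ _ cE J c (fun t => f (g t))) => //.
  exact: smooth_comp.
by move=> t; apply/Hd/He.
Qed.

End localization.

Lemma right_log_near {R : realType} {G : groupType} (p : chart R G)
    (g g' : R -> G) (t : R) : (\forall s \near t, g s = g' s) ->
  right_log_derive p g t = right_log_derive p g' t.
Proof.
move=> gg'; rewrite /right_log_derive (nbhs_singleton gg').
by apply: tvs_derive_near; apply: filterS gg' => s ->.
Qed.

Lemma derive_ext {R : realType} {E : tvsType R} (c d : R -> E) t :
  c =1 d -> tvs_derive c t = tvs_derive d t.
Proof. by move=> /funext ->. Qed.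

Lemma add_eq_sub {V : zmodType} (a b c d : V) : a + b = c + d -> a - c = d - b.
Proof. by move=> e; apply/eqP; rewrite subr_eq addrAC (addrC d) -e addrK. Qed.

Section group.
Context {R : realType} {G : groupType} {I : Type} {A : I -> chart R G}.
Context (hG : lie_group A) {i : I} (hi : chart_dom (A i) 1%g).
Local Notation p := (A i).
Local Notation E := (chart_model (A i)).
Local Notation D := (chart_dom (A i)).
Local Notation inv := (chart_inv (A i)).
Context {ip : E -> E -> R} (hip : weak_inner_product ip).
Implicit Types (t r d : R).

Let cE : convenient E := chart_convenient p.
Let hE : hausdorff_space E := proj1 cE.

Definition gcurve (c : R -> G) := smooth_curve A setT c.

Definition gsurface (k : R -> R -> G) :=
  forall c d : R -> R, smooth c -> smooth d -> gcurve (fun t => k (c t) (d t)).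

Lemma gcurve_open (c : R -> G) : gcurve c -> open (c @^-1` D).
Proof. by move=> /(_ i) /= []; rewrite setTI. Qed.

Lemma gcurve_chart (c : R -> G) : gcurve c -> (forall t, D (c t)) ->
  smooth (fun t => p (c t)).
Proof.
move=> /(_ i) /= []; rewrite setTI => _ sc cD.
by apply: smooth_on_sub sc => t _; exact: cD.
Qed.

Lemma gcurve_mul (c d : R -> G) : gcurve c -> gcurve d ->
  gcurve (fun t => (c t * d t)%g).
Proof. by case: hG => _ H _; exact: H. Qed.

Lemma gcurve_inv (c : R -> G) : gcurve c -> gcurve (fun t => (c t)^-1%g).
Proof. by case: hG => _ _ H; exact: H. Qed.

Lemma gcurve_cst (x : G) : gcurve (fun=> x).
Proof.
move=> j /=; rewrite setTI; split.
  have [xj|xj] := pselect (chart_dom (A j) x).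
    suff -> : (fun=> x) @^-1` chart_dom (A j) = [set: R] by exact: openT.
    by apply/seteqP; split.
  suff -> : (fun=> x) @^-1` chart_dom (A j) = (set0 : set R) by exact: open0.
  by apply/seteqP; split.
apply: smooth_on_sub (smooth_cstE (A j x) _) => //.
by case: (chart_convenient (A j)).
Qed.

Lemma gcurve_comp (c : R -> G) (f : R -> R) : gcurve c -> smooth f ->
  gcurve (fun t => c (f t)).
Proof.
move=> sc sf j; have /= := sc j; rewrite !setTI => -[oJ sJ]; split.
  apply: (@open_comp _ _ f (c @^-1` chart_dom (A j))) => // t _.
  exact: (@smooth_continuous _ _ sf).
by apply: (smooth_on_comp_local (chart_convenient (A j)) oJ sJ sf).
Qed.

Lemma gsurface_swap k : gsurface k -> gsurface (fun t r => k r t).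
Proof. by move=> sk c d sc sd; exact: sk. Qed.

Lemma gsurface_mul k l : gsurface k -> gsurface l ->
  gsurface (fun t r => (k t r * l t r)%g).
Proof. by move=> sk sl c d sc sd; apply: gcurve_mul; [exact: sk|exact: sl]. Qed.

Lemma gsurface_inv k : gsurface k -> gsurface (fun t r => (k t r)^-1%g).
Proof. by move=> sk c d sc sd; apply: gcurve_inv; exact: sk. Qed.

Lemma gsurface_cst x : gsurface (fun _ _ => x).
Proof. by move=> c d sc sd; exact: gcurve_cst. Qed.

Lemma gsurface_comp k (f g : R -> R -> R) : gsurface k -> smooth2 f ->
  smooth2 g -> gsurface (fun t r => k (f t r) (g t r)).
Proof. by move=> sk sf sg c d sc sd; apply: sk; [exact: sf|exact: sg]. Qed.

Lemma smooth2_snd : smooth2 (fun t r : R => r).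
Proof. by []. Qed.

Lemma smooth2_of1 (f : R -> R) : smooth f -> smooth2 (fun t _ : R => f t).
Proof. by move=> sf c d sc sd; exact: smooth_comp. Qed.

Lemma gsurface_curve c (f : R -> R -> R) : gcurve c -> smooth2 f ->
  gsurface (fun t r => c (f t r)).
Proof. by move=> gc sf a b sa sb; apply: gcurve_comp => //; exact: sf. Qed.

Lemma gsurface_1 k r : gsurface k -> gcurve (fun t => k t r).
Proof. by move=> sk; apply: sk; [exact: smooth_id|exact: smooth_cst]. Qed.

Lemma gsurface_2 k t : gsurface k -> gcurve (k t).
Proof. by move=> sk; apply: (sk (fun=> t)); [exact: smooth_cst|exact: smooth_id]. Qed.

(** In any other chart the curve reads as the transition map applied to c, which is
    smooth once c is clamped to the domain of that map. *)
Lemma gcurve_chart_inv (c : R -> E) : smooth c ->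
  (forall t, (p @` D) (c t)) -> gcurve (fun t => inv (c t)).
Proof.
move=> sc cU j; rewrite setTI.
have [[[_ atlas] _] _ _] := hG; have [oV sV] := atlas i j.
set J := _ @^-1` _; have -> : J = c @^-1` (p @` (D `&` chart_dom (A j))).
  apply/seteqP; split => t.
    rewrite /J /=; have [z Dz <-] := cU t.
    by rewrite chart_mapK// => zj; exists z.
  by rewrite /J /= => -[z [Dz zj] <-]; rewrite chart_mapK.
split; first exact: oV.
apply: smooth_on_local => t0 Jt0.
have [d d0 Hd] := open_ball1 (oV _ sc) Jt0.
have [g [sg g0 gd gn]] := exists_clamp t0 d0.
exists (fun t => A j (inv (c (g t)))); split; last by apply: filterS gn => t /= ->.
apply: (sV (fun t => c (g t))); first exact: smooth_compE.
by move=> t; apply: Hd.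
Qed.

Lemma gsurface_chart_inv (F : R -> R -> E) : smooth2 F ->
  (forall t r, (p @` D) (F t r)) -> gsurface (fun t r => inv (F t r)).
Proof. by move=> sF FU c d sc sd; apply: gcurve_chart_inv => //; exact: sF. Qed.

Lemma gsurface_near k t0 r0 : gsurface k -> D (k t0 r0) ->
  near2 t0 r0 (fun t r => D (k t r)).
Proof.
move=> sk kD; apply: near2_curve => a b sa sb a0 b0.
have := open_nbhs_nbhs; apply; split; first exact: (gcurve_open (sk _ _ sa sb)).
by rewrite /= a0 b0.
Qed.

(** Clamping the parameters keeps the surface in the chart domain, so the germ of
    its chart expression extends to the whole plane. *)
Lemma gsurface_chart k t0 r0 : gsurface k -> D (k t0 r0) ->
  exists2 F : R -> R -> E, smooth2 F & near2 t0 r0 (fun t r => p (k t r) = F t r).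
Proof.
move=> sk kD; have [d d0 Hd] := gsurface_near sk kD.
have [f [sf f0 fd fn]] := exists_clamp t0 d0.
have [g [sg g0 gd gn]] := exists_clamp r0 d0.
exists (fun t r => p (k (f t) (g r))).
  move=> a b sa sb; apply: gcurve_chart => [|t]; last exact: Hd.
  by apply: sk; exact: smooth_comp.
by apply: near2_sub (near2_product (fun _ _ => True) fn gn) => t r [-> ->].
Qed.

Lemma smooth_gpartial k : gsurface k -> (forall t, D (k t 0)) ->
  smooth (fun t => tvs_derive (fun r => p (k t r)) 0).
Proof.
move=> sk kD; apply: smooth_on_local => t0 _.
have [F sF [d d0 Fk]] := gsurface_chart sk (kD t0).
exists (fun t => tvs_derive (F t) 0); split; first exact: smooth_partialE.
apply: filterS (near_dist t0 d0) => t tt; apply: tvs_derive_near.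
by apply: filterS (near_dist (0 : R) d0) => r rr; exact: Fk.
Qed.

(** ** The right logarithmic derivative *)

Lemma smooth2_right_log h : gsurface h ->
  smooth2 (fun s t => right_log_derive p (h s) t).
Proof.
move=> sh c d sc sd.
pose k t r := (h (c t) (r + d t) * (h (c t) (d t))^-1)%g.
have sk : gsurface k.
  apply: gsurface_mul; last apply: gsurface_inv.
    apply: gsurface_comp => //; first exact: smooth2_of1.
    by move=> a b sa sb; apply: smoothD => //; exact: smooth_comp.
  by apply: gsurface_comp => //; exact: smooth2_of1.
have -> : (fun t => right_log_derive p (h (c t)) (d t)) =
    (fun t => tvs_derive (fun r => p (k t r)) 0).
  apply/funext => t; rewrite /k.
  rewrite (tvs_derive_shift (fun r => p (h (c t) r * (h (c t) (d t))^-1)%g)).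
  by rewrite add0r.
by apply: smooth_gpartial => // t; rewrite /k add0r mulgV.
Qed.

Lemma right_log_mulr (g : R -> G) x t :
  right_log_derive p (fun r => (g r * x)%g) t = right_log_derive p g t.
Proof.
by apply: derive_ext => s; congr (p _); exact: mulgKA.
Qed.

Lemma right_log_shift (g : R -> G) k t :
  right_log_derive p (fun r => g (r + k)) t = right_log_derive p g (t + k).
Proof.
by rewrite /right_log_derive (tvs_derive_shift (fun s => p (g s * (g (t + k))^-1)%g)).
Qed.

(** ** Left invariant vector fields *)

Let p1U : (p @` D) (p 1%g). Proof. by exists 1%g. Qed.

Lemma near2_model (F : R -> R -> E) t0 r0 : smooth2 F -> (p @` D) (F t0 r0) ->
  near2 t0 r0 (fun t r => (p @` D) (F t r)).
Proof.
move=> sF FU; apply: near2_curve => a b sa sb a0 b0.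
apply: open_nbhs_nbhs; split; last by rewrite /= a0 b0.
exact: (chart_image_open (sF _ _ sa sb)).
Qed.

Lemma model_clamp (F : R -> R -> E) : smooth2 F -> F 0 0 = p 1%g ->
  exists F' : R -> R -> E, [/\ smooth2 F', F' 0 0 = p 1%g,
    (forall t r, (p @` D) (F' t r)) & near2 0 0 (fun t r => F t r = F' t r)].
Proof.
move=> sF F0; have [|d d0 Hd] := @near2_model F 0 0 sF; first by rewrite F0.
have [f [sf f0 fd fn]] := exists_clamp (0 : R) d0.
exists (fun t r => F (f t) (f r)); split.
- exact: smooth2_comp.
- by rewrite f0.
- by move=> t r; exact: Hd.
- by apply: near2_sub (near2_product (fun _ _ => True) fn fn) => t r [-> ->].
Qed.

Lemma line_clamp (w : E) : exists f : R -> R, [/\ smooth f, f 0 = 0,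
  (forall s, (p @` D) (p 1%g + f s *: w)) & \forall s \near 0, f s = s].
Proof.
have [||d d0 Hd] := @open_ball1 R ((fun s => p 1%g + s *: w) @^-1` (p @` D)) 0.
- apply: (chart_image_open (smooth_lineE cE (p 1%g) w (@smooth_id R))).
- by rewrite /= scale0r addr0.
have [f [sf f0 fd fn]] := exists_clamp (0 : R) d0.
by exists f; split => // s; exact: Hd.
Qed.

Lemma gsurface_smooth_at g : D g ->
  smooth_at (fun y : E => p (g * inv y)%g) (p 1%g).
Proof.
move=> Dg F sF F0; have [F' [sF' F'0 F'U FF']] := model_clamp sF F0.
have [||H sH Hk] := @gsurface_chart (fun t r => (g * inv (F' t r))%g) 0 0.
- by apply: gsurface_mul; [exact: gsurface_cst|exact: gsurface_chart_inv].
- by rewrite F'0 chart_mapK// mulg1.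
by exists H => //; apply: near2_sub (near2_and FF' Hk) => t r [-> <-].
Qed.

Lemma left_inv_field_smooth_at (xi : E) : smooth_at (left_inv_field xi) (p 1%g).
Proof.
move=> F sF F0; have [F' [sF' F'0 F'U FF']] := model_clamp sF F0.
exists (fun t r => left_inv_field xi (F' t r)); last first.
  by apply: near2_sub FF' => t r ->.
move=> c d sc sd; have [f [sf f0 fU fn]] := line_clamp xi.
have -> : (fun t => left_inv_field xi (F' (c t) (d t))) = (fun t => tvs_derive
    (fun s => p (inv (F' (c t) (d t)) * inv (p 1%g + f s *: xi))%g) 0).
  apply/funext => t; apply: tvs_derive_near.
  by apply: filterS fn => s ->.
apply: (@smooth_gpartial
    (fun t s => inv (F' (c t) (d t)) * inv (p 1%g + f s *: xi))%g).
  apply: gsurface_mul; apply: gsurface_chart_inv => //.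
    by move=> a b sa sb; apply: sF'; exact: smooth_comp.
  by move=> a b sa sb; apply: smooth_lineE => //; exact: smooth_comp.
move=> t; rewrite f0 scale0r addr0 chart_mapK// mulg1.
by have [z Dz <-] := F'U (c t) (d t); rewrite chart_mapK.
Qed.

Lemma left_inv_field1 (xi : E) : left_inv_field xi (p 1%g) = xi.
Proof.
rewrite /left_inv_field chart_mapK//.
have [f [sf f0 fU fn]] := line_clamp xi.
rewrite (@tvs_derive_near _ _ _ (fun s => p 1%g + s *: xi)).
  by apply: tvs_is_derive_val => //; exact: tvs_is_derive_line.
apply: filterS fn => s fs; rewrite mul1g -fs.
by have [z Dz <-] := fU s; rewrite chart_mapK.
Qed.

Lemma gcurve_clamp (c : R -> G) : gcurve c -> c 0 = 1%g ->
  exists c' : R -> E, [/\ smooth c', c' 0 = p 1%g &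
    \forall t \near 0, D (c t) /\ p (c t) = c' t].
Proof.
move=> gc c0; have [|d d0 Hd] := @open_ball1 R (c @^-1` D) 0 (gcurve_open gc).
  by rewrite /= c0.
have [f [sf f0 fd fn]] := exists_clamp (0 : R) d0.
exists (fun t => p (c (f t))); split.
- apply: gcurve_chart => [|t]; first exact: gcurve_comp.
  exact: Hd.
- by rewrite f0 c0.
- apply: filterS fn => t ft; split; last by rewrite ft.
  by have := Hd (f t) (fd t); rewrite ft.
Qed.

Lemma derive_left_translate g (c : R -> G) : D g -> gcurve c -> c 0 = 1%g ->
  tvs_derive (fun s => p (g * c s)%g) 0 =
  left_inv_field (tvs_derive (fun s => p (c s)) 0) (p g).
Proof.
move=> Dg gc c0; have [c' [sc' c'0 cc']] := gcurve_clamp gc c0.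
have -> : tvs_derive (fun s => p (c s)) 0 = tvs_derive c' 0.
  by apply: tvs_derive_near; apply: filterS cc' => t [].
have -> : tvs_derive (fun s => p (g * c s)%g) 0 =
    tvs_derive (fun s => p (g * inv (c' s))%g) 0.
  by apply: tvs_derive_near; apply: filterS cc' => t [Dc <-]; rewrite chart_mapK.
rewrite (@tvs_derive_comp _ _ cE _ hip (fun y : E => p (g * inv y)%g))//.
  by rewrite /left_inv_field /dir_derive c'0 chart_mapK.
by rewrite c'0; exact: gsurface_smooth_at.
Qed.

(** Symmetry of second derivatives puts the derivative along be inside, where it is
    a left invariant field at al t; the chain rule then differentiates this field
    along al. *)
Lemma derive_mul_mixed (al be : R -> G) : gcurve al -> gcurve be ->
  al 0 = 1%g -> be 0 = 1%g ->
  tvs_derive (fun s => tvs_derive (fun t => p (al t * be s)%g) 0) 0 =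
  dir_derive (left_inv_field (tvs_derive (fun s => p (be s)) 0)) (p 1%g)
    (tvs_derive (fun t => p (al t)) 0).
Proof.
move=> ga gb a0 b0; pose k t s := (al t * be s)%g.
have sk : gsurface k.
  by apply: gsurface_mul; apply: gsurface_curve.
have [|F sF [d d0 Fk]] := @gsurface_chart k 0 0 sk; first by rewrite /k a0 b0 mulg1.
have -> : tvs_derive (fun s => tvs_derive (fun t => p (al t * be s)%g) 0) 0 =
    partial2 (partial1 F) 0 0.
  apply: tvs_derive_near; apply: filterS (near_dist (0 : R) d0) => s sd.
  apply: tvs_derive_near; apply: filterS (near_dist (0 : R) d0) => t td.
  exact: Fk.
apply: etrans (esym (partial12 cE hip 0 0 sF)) _.
have [al' [sal' al'0 aal']] := gcurve_clamp ga a0.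
have -> : tvs_derive (fun t => p (al t)) 0 = tvs_derive al' 0.
  by apply: tvs_derive_near; apply: filterS aal' => t [].
set eta := tvs_derive (fun s => p (be s)) 0.
have sat : smooth_at (left_inv_field eta) (al' 0).
  by rewrite al'0; exact: left_inv_field_smooth_at.
rewrite -al'0; apply: etrans _ (tvs_derive_comp cE hip sat sal').
apply: tvs_derive_near; near=> t.
have [Da <-] : D (al t) /\ p (al t) = al' t by near: t.
rewrite -derive_left_translate// /partial2.
apply: tvs_derive_near; apply: filterS (near_dist (0 : R) d0) => s sd.
apply/esym/Fk => //; near: t; exact: near_dist.
Unshelve. all: by end_near. Qed.

(** * The Maurer-Cartan equation *)

(** Write h(s,t) = k(s,t) h(s,0) with k(s,t) = h(s,t) h(s,0)^-1, whose t-derivative at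
    t = 0 is the right logarithmic derivative.  Giving the two factors separate
    parameters s and r and differentiating along s = r yields the two summands. *)
Lemma derive_right_log_split h : gsurface h -> h 0 0 = 1%g ->
  tvs_derive (fun s => tvs_derive (fun t => p (h s t)) 0) 0 =
  tvs_derive (fun s => right_log_derive p (h s) 0) 0 +
  tvs_derive (fun s => tvs_derive (fun t => p (h 0 t * h s 0)%g) 0) 0.
Proof.
move=> sh h0.
have [|d d0 Hd] := @open_ball1 R ((fun s => h s 0) @^-1` D) 0
   (gcurve_open (gsurface_1 0 sh)); first by rewrite /= h0.
have [f [sf f0 fd fn]] := exists_clamp (0 : R) d0.
pose Q s r := tvs_derive (fun t => p (h s t * (h s 0)^-1 * h (f r) 0)%g) 0.
have sQ : smooth2 Q.
  move=> a b sa sb.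
  apply: (@smooth_gpartial (fun l t => (h (a l) t * (h (a l) 0)^-1 * h (f (b l)) 0)%g)).
    apply: gsurface_mul; first apply: gsurface_mul.
    - by apply: gsurface_comp => //; exact: smooth2_of1.
    - apply: gsurface_inv; apply: (gsurface_curve (gsurface_1 0 sh)).
      exact: smooth2_of1.
    - apply: (gsurface_curve (gsurface_1 0 sh)).
      by apply: smooth2_of1; exact: smooth_comp.
  by move=> l; rewrite mulgV mul1g; exact: Hd.
have E0 : tvs_derive (fun s => tvs_derive (fun t => p (h s t)) 0) 0 =
    tvs_derive (fun s => Q s s) 0.
  apply: tvs_derive_near; apply: filterS fn => s fs; rewrite /Q fs.
  by apply: derive_ext => t; rewrite mulgVK.
have E1 : partial1 Q 0 0 = tvs_derive (fun s => right_log_derive p (h s) 0) 0.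
  apply: derive_ext => s; rewrite /Q f0 h0.
  by apply: derive_ext => t; rewrite mulg1.
have E2 : partial2 Q 0 0 =
    tvs_derive (fun s => tvs_derive (fun t => p (h 0 t * h s 0)%g) 0) 0.
  apply: tvs_derive_near; apply: filterS fn => s fs; rewrite /Q fs h0.
  by apply: derive_ext => t; rewrite invg1 mulg1.
apply: etrans E0 (etrans (tvs_derive_diag cE hip 0 sQ) _).
by rewrite E1 E2.
Qed.

(** Both orders of differentiation of h give the same mixed derivative; the difference
    of the two decompositions by [derive_right_log_split] contains the two mixed
    derivatives of the product, that is, the bracket. *)
Lemma maurer_cartan1 h : gsurface h -> h 0 0 = 1%g ->
  tvs_derive (fun s => right_log_derive p (h s) 0) 0 -
  tvs_derive (fun t => right_log_derive p (h^~ t) 0) 0 =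
  - lie_ad (right_log_derive p (h 0) 0) (right_log_derive p (h^~ 0) 0).
Proof.
move=> sh h0; have shs := gsurface_swap sh.
have e1 := derive_right_log_split sh h0.
have e2 := @derive_right_log_split (fun t s => h s t) shs h0.
have h2 : right_log_derive p (h 0) 0 = tvs_derive (fun t => p (h 0 t)) 0.
  by apply: derive_ext => t; rewrite h0 invg1 mulg1.
have h1 : right_log_derive p (h^~ 0) 0 = tvs_derive (fun t => p (h t 0)) 0.
  by apply: derive_ext => t; rewrite h0 invg1 mulg1.
rewrite (derive_mul_mixed (gsurface_2 0 sh) (gsurface_1 0 sh) h0 h0) -h1 -h2 in e1.
rewrite (derive_mul_mixed (gsurface_1 0 sh) (gsurface_2 0 sh) h0 h0) -h1 -h2 in e2.
have [|F sF [d d0 Fk]] := @gsurface_chart h 0 0 sh; first by rewrite h0.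
have e3 : tvs_derive (fun s => tvs_derive (fun t => p (h s t)) 0) 0 =
    tvs_derive (fun t => tvs_derive (fun s => p (h s t)) 0) 0.
  have -> : tvs_derive (fun s => tvs_derive (fun t => p (h s t)) 0) 0 =
      partial1 (partial2 F) 0 0.
    apply: tvs_derive_near; apply: filterS (near_dist (0 : R) d0) => s sd.
    apply: tvs_derive_near; apply: filterS (near_dist (0 : R) d0) => t td.
    exact: Fk.
  apply: etrans (partial12 cE hip 0 0 sF) _.
  apply: tvs_derive_near; apply: filterS (near_dist (0 : R) d0) => s sd.
  apply: tvs_derive_near; apply: filterS (near_dist (0 : R) d0) => t td.
  by apply/esym/Fk.
rewrite /lie_ad /field_bracket !left_inv_field1 opprB.
exact: add_eq_sub (etrans (esym e1) (etrans e3 e2)).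
Qed.

(** A right translation and a shift of parameters move (s0, t0) to (0, 0) and h there
    to the unit. *)
Lemma maurer_cartan h s0 t0 : gsurface h ->
  tvs_derive (fun s => right_log_derive p (h s) t0) s0 =
  tvs_derive (fun t => right_log_derive p (h^~ t) s0) t0 -
  lie_ad (right_log_derive p (h s0) t0) (right_log_derive p (h^~ t0) s0).
Proof.
move=> sh; pose k s t := (h (s + s0) (t + t0)%R * (h s0 t0)^-1)%g.
have sk : gsurface k.
  apply: gsurface_mul; last exact: gsurface_cst.
  apply: gsurface_comp => // a b sa sb; apply: smoothD => //; exact: smooth_cst.
have k0 : k 0 0 = 1%g by rewrite /k !add0r mulgV.
have kU s t : right_log_derive p (k s) t = right_log_derive p (h (s + s0)) (t + t0).
  by rewrite /k right_log_mulr right_log_shift.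
have kV s t : right_log_derive p (k^~ t) s = right_log_derive p (h^~ (t + t0)) (s + s0).
  by rewrite /k right_log_mulr (right_log_shift (h^~ (t + t0))).
have := maurer_cartan1 sk k0; rewrite kU kV !add0r.
under eq_fun do rewrite kU add0r.
rewrite (tvs_derive_shift (fun s => right_log_derive p (h s) t0)) add0r.
have -> : (fun t => right_log_derive p (k^~ t) 0) =
    (fun t => (fun t => right_log_derive p (h^~ t) s0) (t + t0)).
  by apply/funext => t; rewrite kV add0r.
rewrite (tvs_derive_shift (fun t => right_log_derive p (h^~ t) s0)) add0r.
by move=> /eqP; rewrite subr_eq addrC => /eqP.
Qed.

End group.
Arguments gcurve {R G I} A c.
Arguments gsurface {R G I} A k.

(** * The first variation of the energy *)

Section interval.
Context {R : realType}.
Implicit Types (a b d t x : R) (f : R -> R).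
Local Notation mu := (@lebesgue_measure R).

Lemma interval_clamp a b d : a <= b -> 0 < d -> exists f, [/\ smooth f,
  (forall t, f t \in `]a - d, b + d[) &
  (forall t, a - d / 2 < t < b + d / 2 -> f t = t)].
Proof.
move=> ab d0; pose m := (a + b) / 2; pose l := (b - a) / 2.
have l0 : 0 <= l by rewrite /l; lra.
exists (soft_clamp m (l + d / 2) (l + d)); split.
- exact: smooth_soft_clamp.
- move=> t; have : `|soft_clamp m (l + d / 2) (l + d) t - m| < l + d.
    by apply: soft_clamp_lt; lra.
  rewrite in_itv/= ltr_distl => /andP[]; rewrite /m /l => ? ?.
  by apply/andP; split; lra.
- move=> t /andP[ta tb]; apply: soft_clamp_id; try lra.
  by rewrite ler_distl /m /l; apply/andP; split; lra.
Qed.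

Lemma near_itv (x y t : R) : x < t < y -> \forall s \near t, x < s < y.
Proof.
move=> /andP[xt ty]; near=> s; apply/andP; split; near: s.
  exact: lt_nbhsr.
exact: lt_nbhsl.
Unshelve. all: by end_near. Qed.

Lemma smooth_eq0_closure a b f : a < b -> smooth f ->
  (forall t, a < t < b -> f t = 0) -> forall t, a <= t <= b -> f t = 0.
Proof.
move=> ab sf f0 t /andP[ta tb]; apply/eqP; apply: contraT => ft.
have [d d0 Hd] : exists2 d, 0 < d & forall s, `|s - t| < d -> `|f s - f t| < `|f t|.
  by apply: smooth_continuousD; rewrite ?normr_gt0.
pose k := Num.min (1 / 2) (d / (2 * (b - a))).
have k0 : 0 < k by rewrite lt_min !divr_gt0// mulr_gt0// subr_gt0.
have k1 : k <= 1 / 2 by rewrite ge_min lexx.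
have kd : k * (b - a) <= d / 2.
  have : k <= d / (2 * (b - a)) by rewrite ge_min lexx orbT.
  by rewrite invfM mulrA ler_pdivlMr ?subr_gt0.
pose s := t + k * ((a + b) / 2 - t).
have : `|f s - f t| < `|f t|.
  apply: Hd; rewrite /s addrAC subrr add0r normrM (gtr0_norm k0).
  have : `|(a + b) / 2 - t| <= b - a by rewrite ler_norml; apply/andP; split; lra.
  by move=> /(ler_wpM2l (ltW k0)); lra.
by rewrite f0 ?sub0r ?normrN ?ltxx// /s; apply/andP; split; nra.
Qed.

(** The primitive of f is monotone and vanishes at both ends, so it is constant. *)
Lemma integral_ge0_eq0 a b f : a < b -> smooth f ->
  (forall t, a <= t <= b -> 0 <= f t) -> (\int[mu]_(t in `[a, b]) f t)%R = 0 ->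
  forall t, a <= t <= b -> f t = 0.
Proof.
move=> ab sf f0 int0; apply: smooth_eq0_closure => // t /andP[ta tb].
pose F x := (\int[mu]_(s in `[a, x]) f s)%R.
have F0 x : a < x < b -> F x = 0.
  move=> /andP[ax xb]; apply/eqP; rewrite eq_le; apply/andP; split; last first.
    apply: Rintegral_ge0 => s /=; rewrite in_itv/= => /andP[as_ sx].
    by apply: f0; rewrite as_ (le_trans sx)// ltW.
  have e : - F x = (\int[mu]_(s in `]x, b]) f s)%R.
    rewrite -sub0r -int0 /F Rintegral_itvB//.
    - exact: integrable_smooth.
    - by rewrite bnd_simp ltW.
    - by rewrite bnd_simp ltW.
  rewrite -oppr_ge0 e; apply: Rintegral_ge0 => s /=.
  rewrite in_itv/= => /andP[xs sb].
  by apply: f0; rewrite sb andbT ltW// (lt_trans ax).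
have [dF <-] := @continuous_FTC1_closed R f a t b tb (integrable_smooth a b sf) ta
  (@smooth_continuous _ _ sf t).
rewrite derive1E; apply: (@derive_val _ _ _ t 1 F 0).
apply: (is_derive_nearR _ (is_derive_cstR 0 t)).
near=> x; rewrite F0//; apply/andP; split; near: x.
- exact: lt_nbhsr.
- exact: lt_nbhsl.
Unshelve. all: by end_near. Qed.

End interval.

Section first_variation.
Context {R : realType} {G : groupType} {I : Type} {A : I -> chart R G}.
Context (hG : lie_group A) {i : I} (hi : chart_dom (A i) 1%g).
Local Notation p := (A i).
Local Notation E := (chart_model (A i)).
Local Notation D := (chart_dom (A i)).
Local Notation inv := (chart_inv (A i)).
Context {ip : E -> E -> R} (hip : weak_inner_product ip).
Context {adT : E -> E -> E} (hadT : forall xi, is_adjoint ip (lie_ad xi) (adT xi)).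
Context {a b : R} (hab : a < b).
Implicit Types (t r d : R) (h : R -> R -> G).
Local Notation mu := (@lebesgue_measure R).

Let cE : convenient E := chart_convenient p.
Let hE : hausdorff_space E := proj1 cE.

Definition velocity h s t : E := right_log_derive p (h s) t.

Definition variation_field h s t : E := right_log_derive p (h^~ t) s.

Lemma smooth2_velocity h : gsurface A h -> smooth2 (velocity h).
Proof. exact: smooth2_right_log. Qed.

Lemma smooth2_variation_field h : gsurface A h -> smooth2 (variation_field h).
Proof. by move=> /gsurface_swap/smooth2_velocity/smooth2_swap. Qed.

Definition euler_field (u : R -> E) t : E := tvs_derive u t + adT (u t) (u t).

Definition euler_density h t : R :=
  ip (variation_field h 0 t) (euler_field (velocity h 0) t).

Definition flux h s t : R := ip (variation_field h s t) (velocity h s t).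

Definition speed2 h s t : R := ip (velocity h s t) (velocity h s t).

Lemma smooth2_flux h : gsurface A h -> smooth2 (flux h).
Proof.
move=> sh; apply: (smooth2_ip hip); first exact: smooth2_variation_field.
exact: smooth2_velocity.
Qed.

Lemma smooth2_speed2 h : gsurface A h -> smooth2 (speed2 h).
Proof. by move=> sh; apply: (smooth2_ip hip); exact: smooth2_velocity. Qed.

(** The Maurer-Cartan equation, paired with the velocity.  The right-hand side
    exhibits the density as a smooth function of t. *)
Lemma euler_densityE h t : gsurface A h ->
  euler_density h t = partial2 (flux h) 0 t - 2^-1 * partial1 (speed2 h) 0 t.
Proof.
move=> sh; have sU := smooth2_velocity sh; have sV := smooth2_variation_field sh.
have e1 : partial2 (flux h) 0 t =
    ip (tvs_derive (variation_field h 0) t) (velocity h 0 t) +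
    ip (variation_field h 0 t) (tvs_derive (velocity h 0) t).
  apply: is_derive_tvs; apply: (is_derive_ip hip t); exact: smooth2_2.
have e2 : partial1 (speed2 h) 0 t =
    ip (tvs_derive (velocity h ^~ t) 0) (velocity h 0 t) +
    ip (velocity h 0 t) (tvs_derive (velocity h ^~ t) 0).
  apply: is_derive_tvs.
  by apply: (is_derive_ip hip 0 (smooth2_1 t sU) (smooth2_1 t sU)).
have mc := maurer_cartan hG hi hip 0 t sh.
have e3 : tvs_derive (velocity h ^~ t) 0 = tvs_derive (variation_field h 0) t -
    lie_ad (velocity h 0 t) (variation_field h 0 t) := mc.
have [_ ad] := hadT (velocity h 0 t).
rewrite e1 e2 (ip_sym hip (velocity h 0 t)) e3 (ipDl hip) (ipNl hip) ad.
rewrite /euler_density /euler_field (ipDr hip).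
by field.
Qed.

Lemma smooth_euler_density h : gsurface A h -> smooth (euler_density h).
Proof.
move=> sh; have -> : euler_density h =
    (fun t => partial2 (flux h) 0 t - 2^-1 * partial1 (speed2 h) 0 t).
  by apply/funext => t; exact: euler_densityE.
apply: smoothB; first exact: (smooth2_2 0 (smooth2_d2 (smooth2_flux sh))).
apply: smoothM; first exact: smooth_cst.
exact: (smooth2_2 0 (smooth2_d1 (smooth2_speed2 sh))).
Qed.

Lemma variation_field_fixed h t : (forall s, h s t = h 0 t) ->
  variation_field h 0 t = 0.
Proof.
move=> ht; rewrite /variation_field /right_log_derive.
apply: etrans (@derive_ext _ _ _ (fun=> p 1%g) _ _) _; last exact: tvs_derive_cst.
by move=> s; rewrite ht mulgV.
Qed.

(** Integrate [euler_densityE]: the flux contributes boundary terms, which vanish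
    because the endpoints are fixed. *)
Lemma is_derive_energy h : gsurface A h ->
  (forall s, h s a = h 0 a) -> (forall s, h s b = h 0 b) ->
  is_derive (0 : R) (1 : R) (fun s => energy ip a b (h s))
    (- (\int[mu]_(t in `[a, b]) euler_density h t)%R).
Proof.
move=> sh ha hb.
have sf := smooth2_flux sh; have ss := smooth2_speed2 sh.
have dE : is_derive (0 : R) (1 : R) (fun s => energy ip a b (h s))
    (2^-1 *: (\int[mu]_(r in `[a, b]) partial1 (speed2 h) 0 r)%R) :=
  is_deriveZ (2^-1 : R) (is_derive_integral 0 (ltW hab) ss).
apply: (is_derive_eq dE).
have i1 := integrable_smooth a b (smooth2_2 0 (smooth2_d1 ss)).
have i2 := integrable_smooth a b (smooth_euler_density sh).
have i3 := integrable_smooth a b (smooth2_2 0 (smooth2_d2 sf)).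
rewrite scaleRE -RintegralZl//.
have -> : (\int[mu]_(t in `[a, b]) (2^-1 * partial1 (speed2 h) 0 t) =
    \int[mu]_(t in `[a, b]) (partial2 (flux h) 0 t - euler_density h t))%R.
  by apply: eq_Rintegral => t _; rewrite euler_densityE// opprB addrC subrK.
rewrite RintegralB//.
have -> : (\int[mu]_(t in `[a, b]) partial2 (flux h) 0 t)%R =
    flux h 0 b - flux h 0 a by exact: (FTC_smooth hab (smooth2_2 0 sf)).
by rewrite /flux !variation_field_fixed// !(ip0l hip) subrr sub0r.
Qed.

(** k(s,t) = c(s psi(t)) g(t), where c follows the straight line through the unit with
    direction w in the chart for small times, and is clamped to the chart domain. *)
Lemma exists_variation (w : E) : exists k : (R -> R) -> (R -> G) -> R -> R -> G,
  forall (psi : R -> R) (g : R -> G), smooth psi -> gcurve A g ->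
  [/\ gsurface A (k psi g), forall t, k psi g 0 t = g t,
      (forall s t, psi t = 0 -> k psi g s t = g t) &
      forall t, variation_field (k psi g) 0 t = psi t *: w].
Proof.
have [f [sf f0 fU fn]] := line_clamp hi w.
exists (fun psi g s t => inv (p 1%g + f (s * psi t)%R *: w) * g t)%g => psi g spsi gg.
have inv1 : inv (p 1%g + f 0 *: w) = 1%g by rewrite f0 scale0r addr0 chart_mapK.
split.
- apply: gsurface_mul => //; last exact: (gsurface_curve gg smooth2_snd).
  apply: gsurface_chart_inv => //.
  move=> c d sc sd; apply: smooth_lineE => //; apply: (smooth_comp sf).
  by apply: smoothM => //; exact: smooth_comp.
- by move=> t; rewrite mul0r inv1 mul1g.
- by move=> s t ->; rewrite mulr0 inv1 mul1g.
- move=> t; rewrite /variation_field right_log_mulr /right_log_derive mul0r inv1.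
  have lim : (s * psi t) @[s --> (0 : R)] --> (0 : R).
    rewrite -[X in _ --> X](mul0r (psi t)).
    by apply: (@cvgM R _ _ _ id (cst (psi t))); [exact: cvg_id|exact: cvg_cst].
  rewrite (@tvs_derive_near _ _ _ (fun s => p 1%g + s *: (psi t *: w))).
    by apply: tvs_is_derive_val => //; exact: tvs_is_derive_line.
  have fn' : \forall s \near (0 : R), f (s * psi t) = s * psi t := lim _ fn.
  apply: filterS fn' => s fs.
  rewrite invg1 mulg1 scalerA -[in RHS]fs.
  by have [z Dz <-] := fU (s * psi t); rewrite chart_mapK.
Qed.

(** A variation h and its base curve are prescribed only near [a, b], and h 0 = g only
    on [a, b] itself.  So h is extended to all parameters by clamping, and the Euler
    equation, which transfers to h 0 in the interior, extends to the endpoints by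
    continuity. *)
Lemma geodesic_of_euler (g : R -> G) (u := right_log_derive p g) :
  (forall t, t \in `[a, b] -> tvs_derive u t = - adT (u t) (u t)) ->
  geodesic A ip a b g.
Proof.
move=> eulerE h [d d0 [sh h0 hs]].
have [f [sf f0 fd fn]] := exists_clamp (0 : R) d0.
have [th [sth thJ thE]] := interval_clamp (ltW hab) d0.
have thE' t : t \in `[a, b] -> th t = t.
  by rewrite in_itv/= => /andP[? ?]; apply: thE; apply/andP; split; lra.
pose k s t := h (f s) (th t).
have sk : gsurface A k.
  move=> c e sc se; apply: sh; try exact: smooth_comp.
  move=> s; split => //=; rewrite in_itv/=.
  by have := fd (c s); rewrite subr0 ltr_norml.
have aab : a \in `[a, b] by rewrite in_itv/= lexx ltW.
have bab : b \in `[a, b] by rewrite in_itv/= lexx andbT ltW.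
have fJ s : f s \in `]- d, d[.
  by rewrite in_itv/=; have := fd s; rewrite subr0 ltr_norml.
have ka s : k s a = g a by rewrite /k thE'//; have [] := hs _ (fJ s).
have kb s : k s b = g b by rewrite /k thE'//; have [] := hs _ (fJ s).
have vk : is_derive (0 : R) (1 : R) (fun s => energy ip a b (k s))
    (- (\int[mu]_(t in `[a, b]) euler_density k t)%R).
  by apply: (is_derive_energy sk) => s; rewrite ?ka ?kb.
have vh : is_derive (0 : R) (1 : R) (fun s => energy ip a b (h s))
    (- (\int[mu]_(t in `[a, b]) euler_density k t)%R).
  apply: is_derive_nearR vk; apply: filterS fn => s fs.
  rewrite /energy; congr (_ * _); apply: eq_Rintegral => t.
  rewrite inE /= in_itv/= => /andP[ta tb].
  rewrite (@right_log_near _ _ _ (k s) (h s))//.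
  have : a - d / 2 < t < b + d / 2 by apply/andP; split; lra.
  by move=> /near_itv; apply: filterS => r /thE rE; rewrite /k fs rE.
apply: (is_derive_eq vh); apply/eqP; rewrite oppr_eq0; apply/eqP.
rewrite -[RHS](mul0r (b - a)) -(Rintegral_cst_itv 0 (ltW hab)).
apply: eq_Rintegral => t; rewrite inE /= in_itv/=.
apply: smooth_eq0_closure hab (smooth_euler_density sk) _ t.
move=> t tab; rewrite /euler_density.
have kg r : a < r < b -> velocity k 0 r = u r.
  move=> rab; apply: right_log_near; apply: filterS (near_itv rab) => s.
  move=> /andP[/ltW sa /ltW sb]; rewrite /k f0 thE' ?h0// in_itv/= sa//.
have -> : euler_field (velocity k 0) t = 0.
  rewrite /euler_field kg// (@tvs_derive_near _ _ _ u); last first.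
    by apply: filterS (near_itv tab); exact: kg.
  rewrite eulerE ?addNr// in_itv/=; case/andP: tab => ta tb.
  by rewrite !ltW.
by rewrite (ip_sym hip) (ip0l hip).
Qed.

(** The variations of [exists_variation] turn criticality into the vanishing of the
    integral of psi kappa; the choice of psi makes the integrand nonnegative, so kappa
    vanishes on the open interval and, by continuity, on [a, b]. *)
Lemma euler_of_geodesic (g : R -> G) (u := right_log_derive p g) :
  smooth_path A a b g -> geodesic A ip a b g ->
  forall t, t \in `[a, b] -> tvs_derive u t = - adT (u t) (u t).
Proof.
move=> hg geo t tab.
have [d d0 sg] := hg.
have [th [sth thJ thE]] := interval_clamp (ltW hab) d0.
have thE' s : s \in `[a, b] -> th s = s.
  by rewrite in_itv/= => /andP[? ?]; apply: thE; apply/andP; split; lra.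
pose g' s := g (th s).
have gg' : gcurve A g'.
  move=> j; have /= [oJ sJ] := sg j; rewrite setTI.
  rewrite (_ : _ @^-1` _ = th @^-1` (`]a - d, b + d[ `&` g @^-1` chart_dom (A j))).
    split; last exact: (smooth_on_comp_local (chart_convenient (A j)) oJ sJ sth).
    by apply: open_comp => // s _; exact: (@smooth_continuous _ _ sth).
  by apply/seteqP; split => s /=; [move=> gs; split => //; exact: thJ|case].
pose u' := right_log_derive (A i) g'.
have u'E s : a - d / 2 < s < b + d / 2 -> u' s = u s.
  move=> /near_itv sn; apply: right_log_near; apply: filterS sn => r /thE.
  by rewrite /g' => ->.
have tab' : a - d / 2 < t < b + d / 2.
  by move: tab; rewrite in_itv/= => /andP[? ?]; apply/andP; split; lra.
have -> : tvs_derive u t = tvs_derive u' t.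
  apply: tvs_derive_near; apply: filterS (near_itv tab') => s /u'E ->.
  by [].
rewrite -u'E//.
suff ip0 w : ip w (euler_field u' t) = 0.
  by apply/eqP; rewrite -addr_eq0; apply/eqP; exact: (ip_eq0 hip (ip0 _)).
have [k Hk] := exists_variation w.
have [s1 k1 _ v1] := Hk (fun=> 1) g' (@smooth_cst R 1) gg'.
pose kappa s := ip w (euler_field u' s).
have densE (psi : R -> R) : smooth psi -> forall s,
    euler_density (k psi g') s = psi s * kappa s.
  move=> spsi s; have [sk k0 _ vk] := Hk psi g' spsi gg'.
  rewrite /euler_density vk (ipZl hip) /kappa; congr (_ * ip _ _).
  have -> // : velocity (k psi g') 0 = u'.
  apply/funext => r.
  exact: (congr1 (fun c => right_log_derive (A i) c r) (funext k0)).
have skappa : smooth kappa.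
  have := smooth_euler_density s1; congr smooth.
  by apply/funext => s; rewrite densE ?mul1r//; exact: smooth_cst.
(* psi vanishes at the endpoints, and psi * kappa is nonnegative on [a, b] *)
pose psi s := kappa s * ((s - a) * (b - s)).
have spsi : smooth psi.
  apply: smoothM => //; apply: smoothM; apply: smoothB; try exact: smooth_cst;
    exact: smooth_id.
have [sk k0 kfix vk] := Hk psi g' spsi gg'.
have aab : a \in `[a, b] by rewrite in_itv/= lexx ltW.
have bab : b \in `[a, b] by rewrite in_itv/= lexx andbT ltW.
have psia : psi a = 0 by rewrite /psi subrr mul0r mulr0.
have psib : psi b = 0 by rewrite /psi subrr !mulr0.
have vark : Defs.variation A a b g (k psi g').
  exists d => //; split.
  - by move=> c e sc se _; exact: sk.
  - by move=> s sab; rewrite k0 /g' thE'.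
  - by move=> s _; rewrite !kfix// /g' !thE'.
have := geo _ vark.
have vE : is_derive (0 : R) (1 : R) (fun s => energy ip a b (k psi g' s))
    (- (\int[mu]_(s in `[a, b])
      euler_density (k psi g') s)%R).
  by apply: (is_derive_energy sk) => s; rewrite !kfix.
move=> /is_derive_tvs; rewrite (is_derive_tvs vE) => /eqP; rewrite oppr_eq0 => /eqP.
under eq_Rintegral do rewrite densE//.
move=> int0; have : forall s, a <= s <= b -> psi s * kappa s = 0.
  apply: (@integral_ge0_eq0 _ a b (fun s => psi s * kappa s)) => //.
    exact: smoothM.
  move=> s /andP[sa sb]; rewrite /psi mulrAC -expr2.
  by rewrite mulr_ge0 ?sqr_ge0// mulr_ge0// subr_ge0.
move=> psik; have tab2 : a <= t <= b by move: tab; rewrite in_itv.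
apply: (@smooth_eq0_closure _ a b kappa hab skappa _ t tab2).
move=> s /andP[sa sb]; have := psik s; rewrite !ltW// => /(_ isT)/eqP.
rewrite /psi mulrAC !mulf_eq0 !subr_eq0 orbb (gt_eqF sa) (gt_eqF sb) !orbF.
by move/eqP.
Qed.

End first_variation.

Theorem mainTheorem2 (R : realType) (G : groupType) (I : Type) (A : I -> chart R G)
  (hG : lie_group A)
  (i : I) (hi : chart_dom (A i) 1%g)
  (ip : chart_model (A i) -> chart_model (A i) -> R) (hip : weak_inner_product ip)
  (adT : chart_model (A i) -> chart_model (A i) -> chart_model (A i))
  (hadT : forall xi, is_adjoint ip (lie_ad xi) (adT xi))
  (a b : R) (hab : a < b) (g : R -> G) (hg : smooth_path A a b g) :
  let u := right_log_derive (A i) g in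
  geodesic A ip a b g <->
  (forall t, t \in `[a, b] -> tvs_derive u t = - adT (u t) (u t)).
Proof.
split=> [geo t tab|eulerE].
  exact: (euler_of_geodesic hG hi hip hadT hab hg geo).
exact: (geodesic_of_euler hG hi hip hadT hab eulerE).
Qed.
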